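(* Fix a grid time $t\in\{0,\delta t,\dots,T\}$ and consider the discrete-time dark-pool control problem described in the context, with state $X^D_s=(p_s,q^D_s)^T$, control $y_s\in\mathbb R$, dynamics $$X^D_{s+\delta t}=\begin{pmatrix}1-\kappa_s\delta t&0\\0&1\end{pmatrix}X^D_s-\frac{a_s}{v_s}\epsilon^D_s\,y_s\,e_2+\begin{pmatrix}\alpha_s\delta t+\sigma_{s,\delta t}z_s\\0\end{pmatrix},\qquad s=t,\dots,T-\delta t,$$ and value function $H^D$. Let $\mathcal I=\mathrm{diag}(1,1)$, $\mathcal J=\mathrm{diag}(1,0)$, $e_1=(1,0)^T$, $e_2=(0,1)^T$, $\Delta^D_s=\begin{pmatrix}0&0\\0&\beta^D_s\end{pmatrix}$. Define backward in time, from $$P^D_T=\begin{pmatrix}0&0\\0&\tilde\beta^D_T\end{pmatrix},\qquad b^D_T=(0,0)^T,\qquad e^D_T=0,$$ for $s=T-\delta t,\dots,t$, $$g^D_s=\theta^D_s+\frac{a_s}{v_s}e_2^TP^D_{s+\delta t}e_2,\qquad (k^D_s)^T=-(g^D_s)^{-1}\Big[-e_2^T(P^D_{s+\delta t})^T(\mathcal I-\kappa_s\delta t\,\mathcal J)+\tfrac12e_1^T\Big],$$ $$f^D_s=-\tfrac12(g^D_s)^{-1}\Big[-e_2^Tb^D_{s+\delta t}-2\alpha_s\delta t\,e_1^TP^D_{s+\delta t}e_2+\Big(\frac{v_s\theta^D_s}{\lambda^D_s}+\eta_s\Big)\langle u\rangle_t\Big],$$ $$P^D_s=P^D_{s+\delta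 t}-\kappa_s\delta t(\mathcal JP^D_{s+\delta t}+P^D_{s+\delta t}\mathcal J)+\kappa_s^2(\delta t)^2\mathcal JP^D_{s+\delta t}\mathcal J+\Big[\Delta^D_s-\frac{a_s\lambda^D_s}{v_s}g^D_sk^D_s(k^D_s)^T\Big]\delta t,$$ $$b^D_s=b^D_{s+\delta t}-\Big\{2\frac{a_s\lambda^D_s}{v_s}g^D_sf^D_sk^D_s+\kappa_s\mathcal Jb^D_{s+\delta t}-2\alpha_s(\mathcal I-\kappa_s\delta t\,\mathcal J)P^D_{s+\delta t}e_1\Big\}\delta t,$$ $$e^D_s=e^D_{s+\delta t}+\big[\sigma_{s,\delta t}^2+\alpha_s^2(\delta t)^2\big]e_1^TP^D_{s+\delta t}e_1+\Big[\alpha_s(b^D_{s+\delta t})^Te_1-\frac{a_s\lambda^D_s}{v_s}g^D_s(f^D_s)^2\Big]\delta t.$$ Then for every grid time $s$ with $t\le s\le T$ and every $X^D=(p,q^D)^T\in\mathbb R^2$, $$H^D(s,X^D)=(X^D)^TP^D_sX^D+(b^D_s)^TX^D+e^D_s,$$ and the optimal control is, for $t\le s\le T-\delta t$, $$y_s^*=(k^D_s)^TX^D_s+f^D_s.$$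
   Context: Time grid: $\delta t>0$, $n\ge1$ an integer, $T=n\delta t$, times $0,\delta t,\dots,T$; sums over time run over the grid. Parameters (deterministic reals): $Q_0>0$, $v_s>0$ (market volume rate), $a_s=v_s/Q_0$, $\eta_s$ (lit temporary impact), $\theta^D_s>0$ (dark impact), $\lambda^D_s>0$ with $\lambda^D_s\delta t\le1$ (dark execution probability per bucket is $\lambda^D_s\delta t$), $\kappa_s$, $\alpha_s$, $\sigma_{s,\delta t}$, $\beta^D_s\ge0$, $\tilde\beta^D_T\ge0$ finite. The number $\langle u\rangle_t\in\mathbb R$ is a constant known at the starting time $t$ (the anticipated average lit participation rate over the remaining period), the same for all $s\ge t$. Randomness: $\epsilon^D_s\in\{0,1\}$ are Bernoulli with $\mathbb P(\epsilon^D_s=1)=\lambda^D_s\delta t$, $z_s$ are standard normal, and all these variables are independent. State: $X^D_s=(p_s,q^D_s)^T$ (price slippage, scaled quantity remaining for the dark pool). Control: $y_s\in\mathbb R$, the quantity posted in the dark pool on $[s,s+\delta t)$, depending only on information available at time $s$ (before $\epsilon^D_s,z_s$ are revealed). Stage cost: for $X^D=(p,q^D)^T$, $$j^D_s(X^D,y)\,\delta t=\Big\{(\delta t)^{-1}\frac{a_s}{v_s}\theta^D_s\epsilon^D_sy^2+(\delta t)^{-1}\frac{a_s}{v_s}p\,\epsilon^D_sy+\Big(\theta^D_s+(\delta t)^{-1}\frac{\eta_s}{v_s}\epsilon^D_s\Big)a_s\langle u\rangle_ty+\beta^D_s(q^D)^2\Big\}\delta t,$$ terminal cost $J^D_T(X^D)=\tilde\beta^D_T(q^D)^2$.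 Value function: $$H^D(s,X^D)=\inf_{(y_r)_{r=s,\dots,T-\delta t}}\mathbb E\Big[\sum_{r=s}^{T-\delta t}j^D_r(X^D_r,y_r)\delta t+J^D_T(X^D_T)\,\Big|\,X^D_s=X^D\Big],$$ the infimum being over adapted square-integrable real controls (no sign constraint). An optimal control is one attaining the infimum. *)

(* Defs.v *)
From HB Require Import structures.
From mathcomp Require Import all_boot all_order all_algebra.
From mathcomp Require Import all_classical all_reals all_analysis.

Set Implicit Arguments.
Unset Strict Implicit.
Unset Printing Implicit Defensive.
Import Order.TTheory GRing.Theory Num.Theory.
Local Open Scope classical_set_scope.
Local Open Scope ring_scope.

(** The grid time [s * dt] is represented by the index [s : nat]; the horizon
    [T] is the index [nstep]. *)

Record dark_market (R : realType) := DarkMarket {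
  dt : R;                (* bucket length *)
  nstep : nat;           (* number of buckets *)
  Q0 : R;                (* initial quantity *)
  vol : nat -> R;        (* v_s, market volume rate *)
  eta : nat -> R;        (* lit temporary impact *)
  theta : nat -> R;      (* dark impact *)
  lambda : nat -> R;     (* dark execution intensity *)
  kappa : nat -> R;
  alpha : nat -> R;
  sigma : nat -> R;
  beta : nat -> R;
  betaT : R              (* terminal penalty *)
}.

Definition mutually_independent d (Omega : measurableType d) (R : realType)
    (Pr : probability Omega R) (I : finType) (X : I -> {RV Pr >-> R}) : Prop :=
  forall (J : {set I}) (B : I -> set R),
    (forall i, i \in J -> measurable (B i)) ->
    Pr (\bigcap_(i in [set` J]) (X i @^-1` B i)) =
    \big[*%E/1%E]_(i in J) Pr (X i @^-1` B i).

Section Coefficients.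
Context (R : realType) (M : dark_market R).
Implicit Types (s : nat) (u : R).

Local Notation dt := (dt M).
Local Notation theta := (theta M).
Local Notation kappa := (kappa M).
Local Notation alpha := (alpha M).
Local Notation lambda := (lambda M).

Definition a_ s : R := vol M s / Q0 M.

Definition e1 : 'cV[R]_2 := delta_mx 0 0.
Definition e2 : 'cV[R]_2 := delta_mx 1 0.
Definition I2 : 'M[R]_2 := 1%:M.
Definition J2 : 'M[R]_2 := delta_mx 0 0.
Definition Delta s : 'M[R]_2 := beta M s *: delta_mx 1 1.

(** One backward step.  [P'], [b'], [e'] stand for the coefficients at time
    [s + dt]; [u] is the anticipated average lit participation rate. *)
Definition g_step s (P' : 'M[R]_2) : R :=
  theta s + a_ s / vol M s * (e2^T *m P' *m e2) 0 0.

Definition k_step s (P' : 'M[R]_2) : 'cV[R]_2 :=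
  (- (g_step s P')^-1 *:
     (- (e2^T *m P'^T *m (I2 - (kappa s * dt) *: J2)) + 2^-1 *: e1^T))^T.

Definition f_step u s (P' : 'M[R]_2) (b' : 'cV[R]_2) : R :=
  - 2^-1 * (g_step s P')^-1 *
    (- (e2^T *m b') 0 0 - 2 * alpha s * dt * (e1^T *m P' *m e2) 0 0
     + (vol M s * theta s / lambda s + eta M s) * u).

Definition P_step s (P' : 'M[R]_2) : 'M[R]_2 :=
  P' - (kappa s * dt) *: (J2 *m P' + P' *m J2)
  + (kappa s ^+ 2 * dt ^+ 2) *: (J2 *m P' *m J2)
  + dt *: (Delta s - (a_ s * lambda s / vol M s * g_step s P')
                       *: (k_step s P' *m (k_step s P')^T)).

Definition b_step u s (P' : 'M[R]_2) (b' : 'cV[R]_2) : 'cV[R]_2 :=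
  b' - dt *: ((2 * (a_ s * lambda s / vol M s) * g_step s P'
                 * f_step u s P' b') *: k_step s P'
              + kappa s *: (J2 *m b')
              - (2 * alpha s) *: ((I2 - (kappa s * dt) *: J2) *m P' *m e1)).

Definition e_step u s (P' : 'M[R]_2) (b' : 'cV[R]_2) (e' : R) : R :=
  e' + (sigma M s ^+ 2 + alpha s ^+ 2 * dt ^+ 2) * (e1^T *m P' *m e1) 0 0
  + (alpha s * (b'^T *m e1) 0 0
     - a_ s * lambda s / vol M s * g_step s P' * f_step u s P' b' ^+ 2) * dt.

(** [coeffs u m] is [(P, b, e)] at grid index [nstep - m]. *)
Fixpoint coeffs u (m : nat) : 'M[R]_2 * 'cV[R]_2 * R :=
  if m is m'.+1 then
    let: (P', b', e') := coeffs u m' in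
    let s := (nstep M - m'.+1)%N in
    (P_step s P', b_step u s P' b', e_step u s P' b' e')
  else (betaT M *: delta_mx 1 1, 0, 0).

Definition PD u s : 'M[R]_2 := (coeffs u (nstep M - s)).1.1.
Definition bD u s : 'cV[R]_2 := (coeffs u (nstep M - s)).1.2.
Definition eD u s : R := (coeffs u (nstep M - s)).2.

Definition gD u s : R := g_step s (PD u s.+1).
Definition kD u s : 'cV[R]_2 := k_step s (PD u s.+1).
Definition fD u s : R := f_step u s (PD u s.+1) (bD u s.+1).

(** [j^D_s(X, y)], as a function of the realised execution indicator [ep]; it
    is multiplied by [dt] in the total cost. *)
Definition stage_cost u s (X : 'cV[R]_2) (ep y : R) : R :=
  let p := X 0 0 in let q := X 1 0 in
  dt^-1 * (a_ s / vol M s) * theta s * ep * y ^+ 2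
  + dt^-1 * (a_ s / vol M s) * p * ep * y
  + (theta s + dt^-1 * (eta M s / vol M s) * ep) * a_ s * u * y
  + beta M s * q ^+ 2.

Definition terminal_cost (X : 'cV[R]_2) : R := betaT M * X 1 0 ^+ 2.

Definition next_state s (X : 'cV[R]_2) (ep zz y : R) : 'cV[R]_2 :=
  (I2 - (kappa s * dt) *: J2) *m X
  - (a_ s / vol M s * ep * y) *: e2
  + (alpha s * dt + sigma M s * zz) *: e1.

End Coefficients.

Section Control.
Context d (Omega : measurableType d) (R : realType) (Pr : probability Omega R).
Context (M : dark_market R) (eps z : nat -> {RV Pr >-> R}).
Implicit Types (s r : nat) (x : 'cV[R]_2) (y : nat -> Omega -> R) (u : R).

Definition noise (i : 'I_(nstep M) + 'I_(nstep M)) : {RV Pr >-> R} :=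
  match i with inl r => eps r | inr r => z r end.

(** Information available at time [r]: the sigma-algebra generated by the
    noises revealed strictly before [r]. *)
Definition info r : set (set Omega) :=
  <<s \bigcup_(i in [set i | (i < r)%N])
        (preimage_set_system setT (eps i) measurable `|`
         preimage_set_system setT (z i) measurable) >>.

(** Adapted square-integrable controls on the times [s, ..., T - dt]; the values
    of [y] at other indices are irrelevant. *)
Definition admissible s y : Prop :=
  forall r, (s <= r < nstep M)%N ->
    preimage_set_system setT (y r) measurable `<=` info r /\
    y r \in Lfun Pr 2%:E.

(** State at time [r >= s] of the system started from [x] at time [s] (it is [x]
    for [r <= s]).  Conditioning on [X_s = x] means starting from [x] at [s]. *)
Fixpoint state s x y r (w : Omega) : 'cV[R]_2 :=
  if r is r'.+1 then
    if (s <= r')%N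
    then next_state M r' (state s x y r' w) (eps r' w) (z r' w) (y r' w)
    else x
  else x.

Definition total_cost u s x y (w : Omega) : R :=
  \sum_(s <= r < nstep M)
     stage_cost M u r (state s x y r w) (eps r w) (y r w) * dt M
  + terminal_cost M (state s x y (nstep M) w).

Definition value u s x : \bar R :=
  ereal_inf [set 'E_Pr[total_cost u s x y]%E | y in admissible s].

Definition optimal u s x y : Prop :=
  admissible s y /\ 'E_Pr[total_cost u s x y]%E = value u s x.

End Control.

(* Main.v *)
Require Import Defs.
From HB Require Import structures.
From mathcomp Require Import all_boot all_order all_algebra finmap.
From mathcomp Require Import all_classical all_reals all_analysis.
From mathcomp Require Import measurable_realfun ring lra.

Set Implicit Arguments.
Unset Strict Implicit.
Unset Printing Implicit Defensive.
Import Order.TTheory GRing.Theory Num.Theory.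
Import numFieldNormedType.Exports.
Import HBNNSimple.
Local Open Scope classical_set_scope.
Local Open Scope ring_scope.

(** The feedback law completes the square.  Along every path, the cost of one
    bucket plus the candidate value at the next state equals the candidate value
    at the current state, plus a positive multiple of the square of
    [y - k^T X - f], plus four noise terms: [eps - lambda dt], [z] and [eps z]
    times functions of the past, and a multiple of [z^2 - 1].  The noise terms
    have zero mean since the noise of a bucket is independent of the past, so
    telescoping gives the expected cost of an admissible control as the candidate
    value plus a weighted sum of the [E (y - k^T X - f)^2].  The weights are
    positive because [P 1 1 >= 0] persists backward in time, which is where
    [lambda dt <= 1] enters. *)

(** * Integration against densities and orthogonality to a sigma-algebra *)

(** Because the identity holds path by path, no dynamic programming principle and no conditional
    expectation is needed: one formula gives the lower bound, its attainment and uniqueness up to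
    null sets. It rests on [eps ^+ 2 = eps], which makes bucket cost plus next value affine in
    [eps]. In its coefficient, [y ^+ 2] has weight [(a / v) * g]: the stage cost gives
    [(a / v) * theta] and the fall of [q] gives [(a / v) ^+ 2 * P 1 1]. The cost [theta * a * u * y]
    carries no [eps]; measured against the mean weight [lambda * dt * a / v] of the other terms it
    becomes the [v * theta / lambda] inside [f]. The obstacle is integrability. Controls are only
    square-integrable, so the coefficient of [eps - lambda dt], quadratic in [y], is merely
    integrable; this suffices because [eps] is bounded. The unbounded [z] only meets terms affine in
    state and control, which are square-integrable. Zero mean is proved as orthogonality: the noise
    integrates to zero over cylinders of past noises, hence over the sigma-algebra they generate,
    hence against every function measurable for it. *)

Lemma nnsfun_sum_indic d (T : measurableType d) (R : realType)
    (h : {nnsfun T >-> R}) :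
  exists (m : nat) (c : 'I_m -> R) (B : 'I_m -> set T),
    [/\ forall i, 0 <= c i, forall i, measurable (B i) &
        forall x, h x = \sum_(i < m) c i * \1_(B i) x].
Proof.
pose s : seq R := fset_set (range h).
exists (size s), (fun i => s`_i), (fun i => h @^-1` [set s`_i]); split.
- move=> i; have : s`_i \in fset_set (range h) by exact: mem_nth.
  by rewrite in_fset_set// => /set_mem[x _ <-]; exact: fun_ge0.
- by move=> i; exact: measurable_sfunP.
- by move=> x; rewrite fimfunEord.
Qed.

(** The hypothesis is the case of indicators; linearity gives simple functions and monotone
    convergence the rest. It turns integrals against the normal law into Lebesgue integrals against
    its density. *)
Lemma ge0_integral_density d (T : measurableType d) (R : realType)
    (mu nu : {measure set T -> \bar R}) (w : T -> R) (f : T -> \bar R) :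
  measurable_fun setT w -> (forall x, 0 <= w x) ->
  (forall A, measurable A -> nu A = (\int[mu]_(x in A) (w x)%:E)%E) ->
  measurable_fun [set: T] f -> (forall x, 0 <= f x)%E ->
  (\int[nu]_x f x = \int[mu]_x (f x * (w x)%:E))%E.
Proof.
move=> mw w0 nuE mf f0.
pose h := nnsfun_approx measurableT mf.
have hE n : (\int[nu]_x (h n x)%:E = \int[mu]_x ((h n x)%:E * (w x)%:E))%E.
  have [m [c [B [c0 mB hE]]]] := nnsfun_sum_indic (h n).
  under [LHS]eq_integral do rewrite hE -sumEFin.
  under [RHS]eq_integral => x _.
    rewrite -EFinM hE mulr_suml -sumEFin; over.
  rewrite !ge0_integral_sum//; first last.
  - by move=> i x _; rewrite lee_fin mulr_ge0.
  - by move=> i; apply/measurable_EFinP/measurable_funM.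
  - by move=> i x _; rewrite lee_fin !mulr_ge0.
  - by move=> i; apply/measurable_EFinP/measurable_funM => //; exact/measurable_funM.
  apply: eq_bigr => i _.
  under eq_integral do rewrite EFinM.
  under [RHS]eq_integral do rewrite -mulrA EFinM.
  rewrite !ge0_integralZl//; first last.
  - by rewrite lee_fin.
  - exact/measurable_EFinP.
  - by rewrite lee_fin.
  - by move=> x _; rewrite lee_fin mulr_ge0.
  - exact/measurable_EFinP/measurable_funM.
  congr (_ * _)%E; rewrite integral_indic// setIT nuE// integral_mkcond.
  apply: eq_integral => x _; rewrite patchE indicE.
  by case: ifPn => _; rewrite ?mul1r ?mul0r.
have lim1 : (\int[nu]_x (h n x)%:E @[n --> \oo] --> \int[nu]_x f x)%E.
  rewrite (_ : integral _ _ f = \int[nu]_x limn (EFin \o h ^~ x))%E; last first.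
    apply: eq_integral => x _; apply/esym/cvg_lim => //.
    by apply: cvg_nnsfun_approx => // y _; exact: f0.
  apply: cvg_monotone_convergence => //.
  - by move=> n; exact/measurable_EFinP.
  - by move=> n x _; rewrite lee_fin.
  - by move=> x _ m n mn; rewrite lee_fin; exact/lefP/nd_nnsfun_approx.
have lim2 : (\int[mu]_x ((h n x)%:E * (w x)%:E) @[n --> \oo] -->
             \int[mu]_x (f x * (w x)%:E))%E.
  have fwE x : (f x * (w x)%:E = limn (fun n => (h n x)%:E * (w x)%:E))%E.
    apply/esym/cvg_lim => //; apply: cvgeZr => //.
    by apply: cvg_nnsfun_approx => // y _; exact: f0.
  rewrite (eq_integral _ _ (fun x _ => fwE x)).
  apply: cvg_monotone_convergence => //.
  - by move=> n; apply/measurable_EFinP/measurable_funM.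
  - by move=> n x _; rewrite -EFinM lee_fin mulr_ge0.
  - move=> x _ m n mn; rewrite -!EFinM lee_fin ler_wpM2r//.
    exact/lefP/nd_nnsfun_approx.
move: lim1; under eq_fun do rewrite hE; move=> lim1.
exact: cvg_unique lim1 lim2.
Qed.

(** Dynkin's argument: the measurable sets over which [F] integrates to zero form a Dynkin class,
    with the total integral handling complements. [F] is signed, so countable additivity comes from
    its integrability. *)
Lemma g_sigma_algebra_integral0 d (T : measurableType d) (R : realType)
    (mu : {measure set T -> \bar R}) (G : set (set T)) (F : T -> \bar R) :
  setI_closed G -> G `<=` measurable -> mu.-integrable setT F ->
  (\int[mu]_x F x = 0)%E ->
  (forall A, G A -> \int[mu]_(x in A) F x = 0)%E ->
  forall A, <<s G >> A -> (\int[mu]_(x in A) F x = 0)%E.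
Proof.
move=> GI Gm iF F0 FG A.
rewrite -setI_closed_g_dynkin_g_sigma_algebra//.
move=> /(_ [set B | measurable B /\ (\int[mu]_(x in B) F x = 0)%E]).
have mF := measurable_int _ iF.
case=> //; split; last by move=> B GB; split; [exact: Gm|exact: FG].
split => /=.
- by split.
- move=> B [mB B0]; split; first exact: measurableC.
  have := F0; rewrite -(setUv B) integral_setU//=.
  + by rewrite B0 add0e.
  + exact: measurableC.
  + by rewrite setUv.
  + exact/disj_setPCl.
- move=> E tE mE; split; first by apply: bigcup_measurable => k _; have [] := mE k.
  rewrite integral_bigcup//.
  + by rewrite eseries0// => i _ _; have [] := mE i.
  + by move=> k; have [] := mE k.
  + by apply: integrableS iF => //; apply: bigcup_measurable => k _; have [] := mE k.
Qed.

(** This stands in for pulling [h] out of a conditional expectation of [F] that vanishes. Only the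
    product is assumed integrable: for [h >= 0], simple functions below [h] give products dominated
    by [|F h|]; the general case splits [h] into positive and negative parts. *)
Lemma integral_mul_orthogonal d (T : measurableType d) (R : realType)
    (mu : {measure set T -> \bar R}) (G : set (set T)) (F h : T -> R) :
  <<s G >> `<=` measurable -> mu.-integrable setT (EFin \o F) ->
  (forall A, <<s G >> A -> \int[mu]_(x in A) (F x)%:E = 0)%E ->
  measurable_fun (setT : set (g_sigma_algebraType G)) h ->
  mu.-integrable setT (EFin \o (F \* h)) ->
  (\int[mu]_x (F x * h x)%:E = 0)%E.
Proof.
move=> Gm iF FG.
have mF : measurable_fun setT F by exact/measurable_EFinP/(measurable_int _ iF).
have mTG (k : T -> R) : measurable_fun (setT : set (g_sigma_algebraType G)) k ->
    measurable_fun (setT : set T) k.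
  by move=> mk _ Y mY; apply: Gm; exact: mk.
have nonneg (k : T -> R) : (forall x, 0 <= k x) ->
    measurable_fun (setT : set (g_sigma_algebraType G)) k ->
    mu.-integrable setT (EFin \o (F \* k)) ->
    (\int[mu]_x (F x * k x)%:E = 0)%E.
  move=> k0 mk iFk.
  have mEk : measurable_fun (setT : set (g_sigma_algebraType G)) (EFin \o k).
    exact/measurable_EFinP.
  (* The approximation lives on [g_sigma_algebraType G], so its level sets belong to [<<s G >>],
     where [F] integrates to zero. *)
  pose f := nnsfun_approx measurableT mEk.
  have f_le n x : f n x <= k x.
    have := @le_approx _ _ R setT (EFin \o k) n x.
    rewrite -lee_fin /f nnsfun_approxE; apply => //.
    by move=> y _; rewrite lee_fin.
  have int0 n : (\int[mu]_x (F x * f n x)%:E = 0)%E.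
    have [m [c [B [c0 mB fE]]]] := nnsfun_sum_indic (f n).
    have mB' i : measurable (B i : set T) by apply: Gm; exact: mB.
    under eq_integral => x _ do rewrite fE mulr_sumr -sumEFin.
    have iFB i : mu.-integrable setT (EFin \o (fun x => F x * \1_(B i) x)).
      apply: le_integrable iF => //.
        exact/measurable_EFinP/measurable_funM.
      move=> x _ /=; rewrite lee_fin normrM indicE.
      by case: (_ \in _); rewrite ?normr1 ?mulr1// normr0 mulr0.
    under eq_integral do under eq_bigr do rewrite mulrCA EFinM.
    rewrite integral_sum//; last first.
      by move=> i; exact: (integrableZl measurableT _ (iFB i)).
    rewrite big1// => i _; rewrite integralZl//; last exact: iFB.
    rewrite (_ : integral _ _ _ = \int[mu]_(x in B i) (F x)%:E)%E.
      by rewrite FG ?mule0//; exact: mB.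
    rewrite [RHS]integral_mkcond; apply: eq_integral => x _.
    by rewrite patchE indicE; case: ifPn; rewrite ?mulr1 ?mulr0.
  have [|||||_ _] := @dominated_convergence _ _ _ mu setT measurableT
    (fun n x => (F x * f n x)%:E) (fun x => (F x * k x)%:E)
    (fun x => `|(F x * k x)%:E|%E).
  - move=> n; apply/measurable_EFinP/measurable_funM => //.
    exact: mTG.
  - exact: (measurable_int _ iFk).
  - apply: aeW => x _; under eq_fun do rewrite EFinM.
    rewrite EFinM; apply: cvgeZl => //.
    by apply: cvg_nnsfun_approx => // y _; rewrite lee_fin.
  - exact: integrable_abse.
  - apply: aeW => x n _; rewrite lee_fin !normrM ler_wpM2l//.
    by rewrite ger0_norm// ger0_norm.
  under eq_fun do rewrite int0.
  by move=> H; apply/esym; apply: cvg_unique (cvg_cst _) H.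
move=> mh iFh.
have hE x : h x = h^\+ x - h^\- x.
  rewrite /funrpos /funrneg.
  by case: (leP (h x) 0) => ?; case: (leP (- h x) 0) => ?; lra.
have ipos : mu.-integrable setT (EFin \o (F \* h^\+)).
  apply: le_integrable iFh => //.
    by apply/measurable_EFinP/measurable_funM => //; apply/measurable_funrpos/mTG.
  move=> x _; rewrite lee_fin !normrM ler_wpM2l// /funrpos.
  by case: (leP (h x) 0) => hx; rewrite ?normr0.
have ineg : mu.-integrable setT (EFin \o (F \* h^\-)).
  apply: le_integrable iFh => //.
    by apply/measurable_EFinP/measurable_funM => //; apply/measurable_funrneg/mTG.
  move=> x _; rewrite lee_fin !normrM ler_wpM2l// /funrneg.
  by case: (leP (- h x) 0) => hx; rewrite ?normr0 ?normrN.
under eq_integral do rewrite hE mulrBr EFinB.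
rewrite integralB// nonneg ?nonneg ?sube0//.
- exact/measurable_funrneg.
- exact/measurable_funrpos.
Qed.

(** * Moments of the standard normal law *)

Section standard_normal_moments.
Context {R : realType}.
Local Notation mu := (@lebesgue_measure R).
Local Notation phi := (normal_pdf (0 : R) 1).

Lemma standard_normal_pdfE (x : R) : phi x = normal_peak 1 * expR (- x ^+ 2 / 2).
Proof.
by rewrite normal_pdfE ?oner_neq0// /normal_fun subr0 expr1n.
Qed.

Lemma continuous_standard_normal_pdf : continuous phi.
Proof. by apply: continuous_normal_pdf; exact: oner_neq0. Qed.

Lemma is_derive_standard_normal_pdf (x : R) : is_derive x 1 phi (- x * phi x).
Proof.
rewrite (_ : phi = fun x => normal_peak 1 * expR (- x ^+ 2 / 2)); last first.
  by apply/funext => y; exact: standard_normal_pdfE.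
apply: is_derive_eq.
rewrite /GRing.scale/=; set c := normal_peak _; set E := expR _.
by field.
Qed.

(** This is the boundary term of the integration by parts below. From [expR t >= 1 + t] at
    [t = a ^+ 2 / 2], the product [a * phi a] is at most a constant over [a]. *)
Lemma cvg_mul_standard_normal_pdf : n.+1%:R * phi n.+1%:R @[n --> \oo] --> 0.
Proof.
have le n : 0 <= n.+1%:R * phi n.+1%:R <= normal_peak (1 : R) * 2 * harmonic n.
  rewrite mulr_ge0 ?normal_pdf_ge0//= standard_normal_pdfE.
  set a : R := n.+1%:R; set E := expR _.
  have a0 : 0 < a by [].
  have Ea : E * (a ^+ 2 / 2) <= 1.
    rewrite /E mulNr expRN -ler_pdivlMl ?invr_gt0 ?expR_gt0// invrK mulr1.
    by apply: le_trans (expR_ge1Dx _); rewrite lerDr.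
  rewrite mulrCA -[leRHS]mulrA ler_wpM2l ?normal_peak_ge0//.
  have -> : a * E = (E * (a ^+ 2 / 2)) * (2 / a) by field; rewrite gt_eqF.
  by rewrite -[leRHS]mul1r ler_wpM2r// divr_ge0// ltW.
apply: (@squeeze_cvgr _ _ _ _ (cst 0)
  (fun n => normal_peak (1 : R) * 2 * harmonic n)); last 2 first.
- exact: cvg_cst.
- rewrite -[X in _ --> X](mulr0 (normal_peak 1 * 2)).
  by apply: cvgM; [exact: cvg_cst|exact: cvg_harmonic].
- exact: nearW.
Qed.

(* Integrates [(x phi)' = (1 - x^2) phi]. *)
Lemma integral_itv_sqr_standard_normal_pdf (n : nat) :
  (\int[mu]_(x in `[0%R, n.+1%:R]) (phi x)%:E =
   (n.+1%:R * phi n.+1%:R)%:E +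
   \int[mu]_(x in `[0%R, n.+1%:R]) (x ^+ 2 * phi x)%:E)%E.
Proof.
have cphi := continuous_standard_normal_pdf.
have csqr : continuous (fun x : R => x ^+ 2 * phi x).
  by move=> x; apply: cvgM; [exact: exprn_continuous|exact: cphi].
have c1sqr : continuous (fun x : R => (1 - x ^+ 2) * phi x).
  move=> x; apply: cvgM; last exact: cphi.
  by apply: cvgB; [exact: cvg_cst|exact: exprn_continuous].
have cF : continuous (fun x : R => x * phi x).
  by move=> x; apply: cvgM; [exact: cvg_id|exact: cphi].
have cpt (f : R -> R) : continuous f ->
    mu.-integrable `[0, n.+1%:R] (EFin \o f).
  move=> cf; apply: continuous_compact_integrable; first exact: segment_compact.
  exact: continuous_subspaceT.
have dF (x : R) : is_derive x 1 (fun x => x * phi x) ((1 - x ^+ 2) * phi x).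
  have := is_derive_standard_normal_pdf x => dphi.
  apply: is_derive_eq; rewrite /GRing.scale/=; ring.
have := @continuous_FTC2 _ (fun x => (1 - x ^+ 2) * phi x) (fun x => x * phi x)
  0 n.+1%:R.
rewrite mul0r sube0 => <-.
- rewrite -integralD//=; last 2 first.
  + exact: (cpt _ c1sqr).
  + exact: (cpt _ csqr).
  apply: eq_integral => x _; rewrite -EFinD; congr EFin; ring.
- by [].
- exact: continuous_subspaceT.
- split.
  + by move=> x _; exact: ex_derive.
  + by apply: cvg_at_right_filter; exact: cF.
  + by apply: cvg_at_left_filter; exact: cF.
- by move=> x _; rewrite derive1E derive_val.
Qed.

(** As the interval grows the boundary term dies, so [x ^+ 2 * phi x] and [phi x] have equal
    integrals on the half-line. Both are even, so equality extends to the whole line, where the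
    density has mass one. *)
Lemma integral_sqr_standard_normal_pdf :
  (\int[mu]_x (x ^+ 2 * phi x)%:E = 1)%E.
Proof.
have cphi := continuous_standard_normal_pdf.
have csqr : continuous (fun x : R => x ^+ 2 * phi x).
  by move=> x; apply: cvgM; [exact: exprn_continuous|exact: cphi].
have phi0 (x : R) : 0 <= phi x by exact: normal_pdf_ge0.
have sqr0 (x : R) : 0 <= x ^+ 2 * phi x by rewrite mulr_ge0 ?sqr_ge0.
have phiN (x : R) : phi (- x) = phi x by rewrite !standard_normal_pdfE sqrrN.
have set_ge0 : [set x : R | 0 <= x] = `[0, +oo[%classic.
  by apply/seteqP; split => x/=; rewrite in_itv/= andbT.
suff E : (\int[mu]_(x in `[0%R, +oo[) (x ^+ 2 * phi x)%:E =
          \int[mu]_(x in `[0%R, +oo[) (phi x)%:E)%E.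
  rewrite -[RHS](integral_normal_pdf (0 : R) 1).
  rewrite !ge0_symfun_integralT// ?set_ge0 ?E//.
    by move=> x /=; rewrite phiN.
  by move=> x /=; rewrite phiN sqrrN.
have mphi := continuous_measurable_fun cphi.
have msqr := continuous_measurable_fun csqr.
have := @ge0_cvgn_integral _ mu _ phi0 mphi.
rewrite -cvg_shiftS/=; under eq_fun do rewrite integral_itv_sqr_standard_normal_pdf.
have := @ge0_cvgn_integral _ mu _ sqr0 msqr; rewrite -cvg_shiftS/= => lsqr lphi.
have l0 : (n.+1%:R * phi n.+1%:R)%:E @[n --> \oo] --> 0%:E.
  by apply: cvg_EFin; [exact: nearW|exact: cvg_mul_standard_normal_pdf].
rewrite -[LHS]add0e; apply: cvg_unique lphi => //; exact: cvgeD.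
Qed.

Local Notation N := (normal_prob (0 : R) 1).

Let ge0_integral_N (f : R -> R) : measurable_fun setT f -> (forall x, 0 <= f x) ->
  (\int[N]_x (f x)%:E = \int[mu]_x (f x * phi x)%:E)%E.
Proof.
move=> mf f0; under [RHS]eq_integral do rewrite EFinM.
apply: ge0_integral_density => //.
- exact: measurable_normal_pdf.
- by move=> x; exact: normal_pdf_ge0.
- exact/measurable_EFinP.
Qed.

Lemma standard_normal_moment2 : (\int[N]_x (x ^+ 2)%:E = 1)%E.
Proof.
rewrite -integral_sqr_standard_normal_pdf ge0_integral_N//.
by move=> x; rewrite sqr_ge0.
Qed.

Lemma standard_normal_integrable_id : N.-integrable setT (fun x : R => x%:E).
Proof.
(* The second moment is already known, and [|x| <= 1 + x ^+ 2]. *)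
have i2 : N.-integrable setT (fun x : R => (1 + x ^+ 2)%:E).
  apply/integrableP; split; first exact/measurable_EFinP/measurable_funD.
  under eq_integral => x _.
    rewrite gee0_abs ?lee_fin ?addr_ge0 ?sqr_ge0// EFinD; over.
  rewrite ge0_integralD//.
  - rewrite standard_normal_moment2 integral_cst// mul1e.
    apply: lte_add_pinfty; last exact: ltry.
    by apply: (le_lt_trans (@probability_le1 _ _ _ N _ measurableT)); exact: ltry.
  - by move=> x _; rewrite lee_fin sqr_ge0.
  - exact/measurable_EFinP.
apply: le_integrable i2 => //.
  exact/measurable_EFinP.
move=> x _; rewrite lee_fin [leRHS]ger0_norm ?addr_ge0 ?sqr_ge0//.
rewrite ler_norml; apply/andP; split; nra.
Qed.

(* The positive and negative parts of [x] sum to the even function [|x|], whose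
   integral is twice that of the positive part. *)
Lemma standard_normal_moment1 : (\int[N]_x x%:E = 0)%E.
Proof.
pose p x : R := Num.max x 0; pose m x : R := Num.max (- x) 0.
have cphi := continuous_standard_normal_pdf.
have mp : measurable_fun setT p by exact: measurable_maxr.
have mm : measurable_fun setT m.
  by apply: measurable_maxr => //; exact: measurableT_comp.
have p0 x : 0 <= p x by rewrite le_max lexx orbT.
have m0 x : 0 <= m x by rewrite le_max lexx orbT.
have xE x : x = p x - m x.
  by rewrite /p /m; case: (leP x 0) => ?; case: (leP (- x) 0) => ?; lra.
have nE x : `|x| = p x + m x.
  have [x0|x0] := leP 0 x; rewrite ?(ger0_norm x0) ?(ltr0_norm x0) /p /m;
    by case: (leP x 0) => ?; case: (leP (- x) 0) => ?; lra.
have iid := standard_normal_integrable_id.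
have ip : N.-integrable setT (EFin \o p).
  apply: le_integrable iid => //; first exact/measurable_EFinP.
  by move=> x _; rewrite lee_fin (nE x) ger0_norm// lerDl.
have im : N.-integrable setT (EFin \o m).
  apply: le_integrable iid => //; first exact/measurable_EFinP.
  by move=> x _; rewrite lee_fin (nE x) ger0_norm// lerDr.
have pfin := integrable_fin_num measurableT ip.
transitivity (\int[N]_x ((p x)%:E - (m x)%:E))%E.
  by apply: eq_integral => x _; rewrite -EFinB -xE.
rewrite integralB//; suff -> : (\int[N]_x (p x)%:E = \int[N]_x (m x)%:E)%E.
  by rewrite subee//; exact: integrable_fin_num im.
have : (\int[N]_x (p x)%:E + \int[N]_x (m x)%:E = 2%:E * \int[N]_x (p x)%:E)%E.
  rewrite -ge0_integralD//; last 4 first.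
  - by move=> x _; rewrite lee_fin.
  - exact/measurable_EFinP.
  - by move=> x _; rewrite lee_fin.
  - exact/measurable_EFinP.
  under eq_integral do rewrite -EFinD -nE.
  rewrite !ge0_integral_N// ge0_symfun_integralT; last 3 first.
  - by move=> x; rewrite mulr_ge0// normal_pdf_ge0.
  - by move=> x; apply: cvgM; [exact: norm_continuous|exact: cphi].
  - by move=> x /=; rewrite normrN !standard_normal_pdfE sqrrN.
  congr (_ * _)%E; rewrite integral_mkcond; apply: eq_integral => x _.
  rewrite patchE; have [x0|x0] := leP 0 x.
    by rewrite mem_set//= ger0_norm// /p max_l.
  by rewrite memNset /= ?leNgt ?x0// /p max_r ?mul0r// ltW.
rewrite mule_natl mule2n => /(congr1 (fun u => u - \int[N]_x (p x)%:E))%E.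
by rewrite addeK// addeAC subee// add0e => ->.
Qed.

End standard_normal_moments.

(** * Independence and square integrability *)

(* [\1_A - P A] is orthogonal to the sigma-algebra generated by [X]. *)
Lemma integral_indep_event d (T : measurableType d) (R : realType)
    (P : probability T R) (X : {RV P >-> R}) (A : set T) :
  measurable A -> P.-integrable setT (EFin \o X) ->
  (forall B, measurable B -> P (X @^-1` B `&` A) = P (X @^-1` B) * P A)%E ->
  (\int[P]_(x in A) (X x)%:E = P A * \int[P]_x (X x)%:E)%E.
Proof.
move=> mA iX indepXA.
pose G := preimage_set_system setT X measurable.
have mG : <<s G >> `<=` measurable.
  apply: smallest_sub; first exact: (sigma_algebra_measurable T).
  by move=> _ [B mB <-]; rewrite setTI; exact: measurable_funPTI.
pose c := fine (P A).
have cE : c%:E = P A by rewrite fineK// fin_num_measure.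
have m1A : measurable_fun setT (\1_A : T -> R) by exact: measurable_indic.
have mF : measurable_fun setT (fun x => \1_A x - c) by exact: measurable_funB.
have iF : P.-integrable setT (EFin \o (fun x => \1_A x - c)).
  apply: (@le_integrable _ _ _ _ _ _ _ (cst (1 + `|c|)%:E)) => //.
  - exact/measurable_EFinP.
  - move=> x _; rewrite lee_fin [leRHS]ger0_norm// (le_trans (ler_normB _ _))//.
    by rewrite lerD2r indicE; case: (_ \in _); rewrite ?normr1 ?normr0.
  - exact: finite_measure_integrable_cst.
have GE : <<s G >> `<=` G.
  by apply: smallest_sub => //; apply/sigma_algebra_preimage/sigma_algebra_measurable.
have iBA B : measurable B -> P.-integrable B (EFin \o (\1_A : T -> R)).
  move=> mB; apply: (integrableS measurableT) => //.
  exact: integrable_indic.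
have F0 B : <<s G >> B -> (\int[P]_(x in B) (\1_A x - c)%:E = 0)%E.
  move=> sB; have mB := mG _ sB; have [B' mB' BE] := GE _ sB.
  under eq_integral do rewrite EFinB.
  rewrite integralB//; last 2 first.
  - exact: iBA.
  - exact: finite_measure_integrable_cst.
  have PAB : (P (A `&` B) = P B * P A)%E.
    by rewrite setIC -BE setTI; exact: indepXA.
  rewrite integral_indic// integral_cst//.
  suff : (P (A `&` B) - c%:E * P B = 0)%E by [].
  rewrite cE PAB muleC subee//.
  by rewrite fin_numM// fin_num_measure.
have iFX : P.-integrable setT (EFin \o ((fun x => \1_A x - c) \* X)).
  apply: (@le_integrable _ _ _ _ _ _ _ (fun x => (1 + `|c|)%:E * (X x)%:E)%E) => //.
  - exact/measurable_EFinP/measurable_funM.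
  - move=> x _; rewrite -EFinM lee_fin !normrM ler_wpM2r//.
    rewrite [leRHS]ger0_norm// (le_trans (ler_normB _ _))//.
    by rewrite lerD2r indicE; case: (_ \in _); rewrite ?normr1 ?normr0.
  - exact: integrableZl.
have mX : measurable_fun (setT : set (g_sigma_algebraType G)) X.
  by move=> _ Y mY; apply: sub_sigma_algebra; exists Y.
have iAX : P.-integrable setT (fun x => (\1_A x)%:E * (X x)%:E)%E.
  apply: le_integrable iX => //.
    by under eq_fun do rewrite -EFinM; exact/measurable_EFinP/measurable_funM.
  move=> x _; rewrite -EFinM lee_fin normrM indicE.
  by case: (_ \in _); rewrite ?normr1 ?mul1r// normr0 mul0r.
have := integral_mul_orthogonal mG iF F0 mX iFX.
under eq_integral do rewrite mulrBl EFinB !EFinM.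
rewrite integralB//; last exact: integrableZl.
rewrite integralZl// cE => /eqP; rewrite sube_eq ?add0e; last 2 first.
- exact: integrable_fin_num.
- by rewrite fin_num_adde_defr.
move=> /eqP <-; rewrite [LHS]integral_mkcond; apply: eq_integral => x _.
by rewrite patchE indicE; case: ifPn; rewrite ?mul1e ?mul0e.
Qed.

Section square_integrable.
Context d (T : measurableType d) (R : realType) (P : probability T R).
Implicit Types f g : T -> R.

Lemma Lfun2P f : measurable_fun setT f ->
  P.-integrable setT (EFin \o (fun x => f x ^+ 2)) -> f \in Lfun P 2%:E.
Proof.
move=> mf /integrableP[_ foo]; rewrite inE; apply/andP; split; rewrite inE//=.
rewrite /finite_norm unlock /Lnorm poweR_lty//=.
apply: le_lt_trans foo; rewrite le_eqVlt; apply/orP; left; apply/eqP.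
by apply: eq_integral => x _; rewrite /= normrX powR_mulrn.
Qed.

Lemma Lfun_measurable p f : f \in Lfun P p -> measurable_fun setT f.
Proof. by move=> /sub_Lfun_mfun; rewrite inE. Qed.

Lemma Lfun2_le f g : measurable_fun setT g -> (forall x, `|g x| <= `|f x|) ->
  f \in Lfun P 2%:E -> g \in Lfun P 2%:E.
Proof.
move=> mg gf f2; apply: Lfun2P => //.
apply: le_integrable (Lfun2_integrable_sqr f2) => //.
  by apply/measurable_EFinP; exact: measurable_funX.
by move=> x _; rewrite lee_fin !normrX lerXn2r ?nnegrE.
Qed.

Lemma Lfun2D f g : f \in Lfun P 2%:E -> g \in Lfun P 2%:E ->
  (fun x => f x + g x) \in Lfun P 2%:E.
Proof.
have [_ LD] := @Lfun_addr_closed _ _ _ P 2%:E (lee1n 2).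
by move=> f2 g2; exact: LD.
Qed.

Lemma Lfun2Z c f : f \in Lfun P 2%:E -> (fun x => c * f x) \in Lfun P 2%:E.
Proof.
move=> f2; have := @Lfun_scale _ _ _ P f c 2 _ f2.
rewrite (_ : c \o* f = fun x => c * f x); last first.
  by apply/funext => x /=; rewrite mulrC.
by apply; rewrite ler1n.
Qed.

Lemma integrable_mul f g : f \in Lfun P 2%:E -> g \in Lfun P 2%:E ->
  P.-integrable setT (fun x => (f x * g x)%:E).
Proof. by move=> f2 g2; apply/Lfun1_integrable/Lfun2_mul_Lfun1. Qed.

Lemma Lfun2_integrable f : f \in Lfun P 2%:E ->
  P.-integrable setT (fun x => (f x)%:E).
Proof.
by move=> f2; apply/Lfun1_integrable/Lfun_subset12 => //; exact: fin_num_measure.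
Qed.

End square_integrable.

(** The product formula over all indices is applied twice, to [D] and to [D] with slot [j] replaced
    by [C]. As [D j] is the full set, the two products differ exactly by the factor of [C]. *)
Lemma mutually_independent_bigcap d (T : measurableType d) (R : realType)
    (P : probability T R) (I : finType) (X : I -> {RV P >-> R}) (j : I)
    (D : I -> set R) (C : set R) :
  mutually_independent X -> (forall i, measurable (D i)) -> D j = setT ->
  measurable C ->
  (P (X j @^-1` C `&` \bigcap_i (X i @^-1` D i)) =
   P (X j @^-1` C) * P (\bigcap_i (X i @^-1` D i)))%E.
Proof.
move=> indep mD Dj mC.
have setTE : [set` [set: I]%SET] = [set: I].
  by apply/seteqP; split => // i _ /=; rewrite inE.
have := indep [set: I]%SET D (fun i _ => mD i).
pose D' i := if i == j then C else D i.
have mD' i : i \in [set: I]%SET -> measurable (D' i).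
  by move=> _; rewrite /D'; case: ifP.
have := indep [set: I]%SET D' mD'.
rewrite setTE (bigD1 j) ?inE//= => D'E.
rewrite (bigD1 j) ?inE//= => ->.
rewrite Dj preimage_setT probability_setT mul1e.
transitivity (P (\bigcap_i X i @^-1` D' i)).
  congr (P _); apply/seteqP; split => x /=.
    by move=> [Xj XD] i _; rewrite /D'; case: eqP => [->//|_]; exact: XD.
  move=> XD'; split; first by have := XD' j Logic.I; rewrite /D' eqxx.
  move=> i _; have [->|ij] := eqVneq i j; first by rewrite Dj.
  by have := XD' i Logic.I; rewrite /D' (negbTE ij).
rewrite D'E /D' eqxx; congr (_ * _)%E.
by apply: eq_bigr => i /andP[_ ij]; rewrite (negbTE ij).
Qed.

Section standard_normal_variable.
Context d (T : measurableType d) (R : realType) (P : probability T R).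
Context (X : {RV P >-> R}).
Context (X_normal : forall B : set R, measurable B ->
  distribution P X B = normal_prob 0 1 B).

(* [normal_prob] lives on [measurableTypeR R], whose display differs from the
   default one carried by [R], hence the change of codomain. *)
Let Y : T -> measurableTypeR R := X.

Let mY : measurable_fun [set: T] Y.
Proof. exact: (measurable_funPT X). Qed.

Let pushforwardE A : measurable A -> A `<=` setT ->
  pushforward P Y A = normal_prob 0 1 A.
Proof. by move=> mA _; exact: X_normal. Qed.

Let ge0_integral_normal (f : R -> R) : measurable_fun [set: R] f ->
  (forall x, 0 <= f x) ->
  (\int[P]_w (f (X w))%:E = \int[normal_prob (0 : R) 1]_x (f x)%:E)%E.
Proof.
move=> mf f0; rewrite -(eq_measure_integral _ pushforwardE).
rewrite (ge0_integral_pushforward mY)//.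
- exact/measurable_EFinP.
- by move=> x _; rewrite lee_fin.
Qed.

Lemma normal_variable_moment2 : (\int[P]_w (X w ^+ 2)%:E = 1)%E.
Proof.
rewrite -(@standard_normal_moment2 R).
by rewrite (@ge0_integral_normal (fun x => x ^+ 2))// => x; rewrite sqr_ge0.
Qed.

Lemma normal_variable_Lfun2 : (X : T -> R) \in Lfun P 2%:E.
Proof.
apply: Lfun2P => //; apply/integrableP; split.
  exact/measurable_EFinP/measurable_funX.
under eq_integral do rewrite /= ger0_norm ?sqr_ge0//.
by rewrite normal_variable_moment2 ltry.
Qed.

Lemma normal_variable_moment1 : (\int[P]_w (X w)%:E = 0)%E.
Proof.
rewrite -(@standard_normal_moment1 R) -(eq_measure_integral _ pushforwardE).
rewrite (integral_pushforward mY)//.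
exact: (Lfun2_integrable normal_variable_Lfun2).
Qed.

End standard_normal_variable.

Section bernoulli_variable.
Context d (T : measurableType d) (R : realType) (P : probability T R).
Context (X : {RV P >-> R}) (p : R).
Context (X01 : forall w, X w = 0 \/ X w = 1).
Context (X_bernoulli : P (X @^-1` [set 1]) = p%:E).

Lemma bernoulli_variable_norm_le1 w : `|X w| <= 1.
Proof. by have [->|->] := X01 w; rewrite ?normr0 ?normr1. Qed.

Lemma bernoulli_variableE w : X w = \1_(X @^-1` [set 1]) w.
Proof.
have [X0|X1] := X01 w; last by rewrite indicE mem_set.
by rewrite indicE memNset//= X0 => /eqP; rewrite eq_sym oner_eq0.
Qed.

Lemma bernoulli_variable_moment1 : (\int[P]_w (X w)%:E = p%:E)%E.
Proof.
under eq_integral do rewrite bernoulli_variableE.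
by rewrite integral_indic// setIT.
Qed.

Lemma bernoulli_variable_mul_Lfun2 (f : T -> R) : f \in Lfun P 2%:E ->
  (fun w => X w * f w) \in Lfun P 2%:E.
Proof.
move=> f2; apply: Lfun2_le (f2) => [|w].
  exact/measurable_funM/(Lfun_measurable f2).
by rewrite normrM ler_piMl// bernoulli_variable_norm_le1.
Qed.

Lemma bernoulli_variable_mul_integrable (f : T -> R) :
  P.-integrable setT (fun w => (f w)%:E) ->
  P.-integrable setT (fun w => (X w * f w)%:E).
Proof.
move=> fi; have mf : measurable_fun setT f.
  exact/measurable_EFinP/(measurable_int _ fi).
apply: le_integrable fi => //; first exact/measurable_EFinP/measurable_funM.
by move=> w _; rewrite lee_fin normrM ler_piMl// bernoulli_variable_norm_le1.
Qed.

(** Trading the factor [X] for a restriction to an event reduces the mean of [eps z] over a cylinder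
    to that of [z] over a smaller cylinder. *)
Lemma integral_bernoulli_variable_mul (A : set T) (f : T -> R) :
  (\int[P]_(w in A) (X w * f w)%:E =
   \int[P]_(w in A `&` X @^-1` [set 1%R]) (f w)%:E)%E.
Proof.
rewrite integral_mkcond [RHS]integral_mkcond; apply: eq_integral => w _.
rewrite !patchE in_setI; case: (w \in A) => //=.
rewrite bernoulli_variableE indicE.
by case: (w \in _); rewrite ?mul1r ?mul0r.
Qed.

End bernoulli_variable.

(** * The information sigma-algebras *)

Section information.
Context d (Omega : measurableType d) (R : realType) (Pr : probability Omega R).
Context (M : dark_market R) (eps z : nat -> {RV Pr >-> R}).
Context (indep : mutually_independent (@noise d Omega R Pr M eps z)).
Local Notation n := (nstep M).
Local Notation noise := (@noise d Omega R Pr M eps z).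

Definition info_gen r : set (set Omega) :=
  \bigcup_(i in [set i | (i < r)%N])
    (preimage_set_system setT (eps i) measurable `|`
     preimage_set_system setT (z i) measurable).

(** Phrased through [g_sigma_algebraType] so that the usual closure properties of [measurable_fun]
    apply to information at time [r]. *)
Definition info_measurable r (f : Omega -> R) : Prop :=
  measurable_fun (setT : set (g_sigma_algebraType (info_gen r))) f.

Lemma info_measurableP r f :
  info_measurable r f <-> preimage_set_system setT f measurable `<=` info eps z r.
Proof.
split=> [mf _ [B mB <-]|mf _ B mB]; first exact: mf.
by apply: mf; exists B.
Qed.

Lemma info_sub r r' : (r <= r')%N -> info eps z r `<=` info eps z r'.
Proof.
move=> rr'; apply: sub_smallest2r; first exact: smallest_sigma_algebra.
apply: bigcup_sub => i /= ir; move=> A GA.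
by exists i => //=; exact: leq_trans ir rr'.
Qed.

Lemma info_measurable_le r r' f : (r <= r')%N ->
  info_measurable r f -> info_measurable r' f.
Proof.
by move=> rr' /info_measurableP fr; apply/info_measurableP => A /fr; exact: info_sub.
Qed.

Lemma info_measurable_eps r : info_measurable r.+1 (eps r).
Proof.
apply/info_measurableP => A GA; apply: sub_sigma_algebra.
by exists r => /=; [exact: ltnSn|left].
Qed.

Lemma info_measurable_z r : info_measurable r.+1 (z r).
Proof.
apply/info_measurableP => A GA; apply: sub_sigma_algebra.
by exists r => /=; [exact: ltnSn|right].
Qed.

Lemma info_gen_measurable r : <<s info_gen r >> `<=` measurable.
Proof.
apply: smallest_sub; first exact: (sigma_algebra_measurable Omega).
move=> _ [i _ [] [B mB <-]]; rewrite setTI; exact: measurable_funPTI.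
Qed.

Definition noise_time (j : 'I_n + 'I_n) : nat :=
  match j with inl k => k | inr k => k end.

(** Unlike the generators of [info r], these sets are stable under intersection, as the Dynkin
    argument requires. Every slot at time [r] or later is the full set, which leaves room to apply
    mutual independence to a noise of that time. *)
Definition cylinder_before (r : nat) : set (set Omega) :=
  [set A | exists D : 'I_n + 'I_n -> set R,
    [/\ forall i, measurable (D i),
        forall i, (r <= noise_time i)%N -> D i = setT &
        A = \bigcap_i (noise i @^-1` D i)]].

Lemma cylinder_before_setI r : setI_closed (cylinder_before r).
Proof.
move=> _ _ [D [mD DT ->]] [D' [mD' DT' ->]].
exists (fun i => D i `&` D' i); split.
- by move=> i; exact: measurableI.
- by move=> i ri; rewrite DT// DT'// setTI.
- by rewrite -bigcapI.
Qed.

Lemma cylinder_before_measurable r : cylinder_before r `<=` measurable.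
Proof.
move=> _ [D [mD _ ->]]; apply: fin_bigcap_measurable => // i _.
exact: measurable_funPTI.
Qed.

Lemma cylinder_beforeT r : cylinder_before r setT.
Proof.
exists (fun=> setT); split => //.
by apply/seteqP; split.
Qed.

(** The bound on [r] places every [i < r] inside the finite index type of [noise], the family whose
    independence is known. *)
Lemma info_gen_sub_cylinder r : (r <= n)%N ->
  info_gen r `<=` cylinder_before r.
Proof.
move=> rn A [i /= ir]; have lt_in : (i < n)%N by exact: leq_trans ir rn.
have gen (j : 'I_n + 'I_n) B : measurable B -> A = noise j @^-1` B ->
    noise_time j = i -> cylinder_before r A.
  move=> mB -> ji; exists (fun k => if k == j then B else setT); split.
  - by move=> k; case: ifP.
  - by move=> k rk; case: eqP => // kj; move: rk; rewrite kj ji leqNgt ir.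
  - apply/seteqP; split => w /=; last by move=> /(_ j Logic.I); rewrite /= eqxx.
    by move=> Bj k _; case: eqP => // ->.
move=> [] [B mB]; rewrite setTI => AE.
- exact: (gen (inl (Ordinal lt_in)) B).
- exact: (gen (inr (Ordinal lt_in)) B).
Qed.

(** For a function with zero integral over every cylinder of the past, the Dynkin argument reaches
    all of [info r], and orthogonality to functions known at time [r] follows. *)
Lemma info_orthogonal r (F h : Omega -> R) : (r <= n)%N ->
  Pr.-integrable setT (EFin \o F) ->
  (forall A, cylinder_before r A -> \int[Pr]_(w in A) (F w)%:E = 0)%E ->
  info_measurable r h ->
  Pr.-integrable setT (EFin \o (F \* h)) ->
  (\int[Pr]_w (F w * h w)%:E = 0)%E.
Proof.
move=> rn iF FA; apply: integral_mul_orthogonal => //.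
  exact: info_gen_measurable.
move=> A sA.
have /(_ A) := g_sigma_algebra_integral0 (@cylinder_before_setI r)
  (@cylinder_before_measurable r) iF (FA _ (cylinder_beforeT r)) FA.
apply; apply: sub_smallest2r sA; first exact: smallest_sigma_algebra.
exact: info_gen_sub_cylinder.
Qed.

Lemma cylinder_before_indep r (j : 'I_n + 'I_n) (A : set Omega) :
  cylinder_before r A -> (r <= noise_time j)%N -> forall B, measurable B ->
  (Pr (noise j @^-1` B `&` A) = Pr (noise j @^-1` B) * Pr A)%E.
Proof.
move=> [D [mD DT ->]] rj B mB; apply: mutually_independent_bigcap => //.
exact: DT.
Qed.

End information.

(** * Zero mean of the noise terms of one bucket *)

Section noise_moments.
Context d (Omega : measurableType d) (R : realType) (Pr : probability Omega R).
Context (M : dark_market R) (eps z : nat -> {RV Pr >-> R}).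
Local Notation n := (nstep M).
Context (eps01 : forall s, (s < n)%N -> forall w, eps s w = 0 \/ eps s w = 1)
  (eps_bernoulli : forall s, (s < n)%N ->
     Pr (eps s @^-1` [set 1]) = (lambda M s * dt M)%:E)
  (z_normal : forall s, (s < n)%N -> forall B : set R, measurable B ->
     distribution Pr (z s) B = normal_prob 0 1 B)
  (indep : mutually_independent (@noise d Omega R Pr M eps z)).
Local Notation info_measurable := (info_measurable eps z).

Lemma eps_mul_Lfun2 r (f : Omega -> R) : (r < n)%N -> f \in Lfun Pr 2%:E ->
  (fun w => eps r w * f w) \in Lfun Pr 2%:E.
Proof. by move=> rn; exact: (bernoulli_variable_mul_Lfun2 (eps01 rn)). Qed.

Lemma z_Lfun2 r : (r < n)%N -> (z r : Omega -> R) \in Lfun Pr 2%:E.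
Proof. by move=> rn; exact: (normal_variable_Lfun2 (z_normal rn)). Qed.

Let eps_integrable r : (r < n)%N -> Pr.-integrable setT (EFin \o eps r).
Proof.
move=> rn; apply: (eq_integrable measurableT (fun w => (eps r w * 1)%:E)) => //.
  by move=> w _; rewrite /= mulr1.
apply: (bernoulli_variable_mul_integrable (eps01 rn)).
exact: finite_measure_integrable_cst.
Qed.

(** Here [h] is only integrable, since it will be quadratic in the control; boundedness of [eps]
    keeps the product integrable. On a cylinder, independence replaces [eps] by its mean
    [lambda dt]. *)
Lemma eps_orthogonal r (h : Omega -> R) : (r < n)%N -> info_measurable r h ->
  Pr.-integrable setT (fun w => (h w)%:E) ->
  Pr.-integrable setT (fun w => ((eps r w - lambda M r * dt M) * h w)%:E) /\
  (\int[Pr]_w ((eps r w - lambda M r * dt M) * h w)%:E = 0)%E.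
Proof.
move=> rn hr ih; set l := lambda M r * dt M.
have iF : Pr.-integrable setT (EFin \o (fun w => eps r w - l)).
  apply: (eq_integrable measurableT (fun w => (eps r w)%:E - l%:E)%E) => //.
  apply: integrableB => //; first exact: eps_integrable.
  exact: finite_measure_integrable_cst.
have iFh : Pr.-integrable setT (fun w => ((eps r w - l) * h w)%:E).
  apply: (eq_integrable measurableT
    (fun w => (eps r w * h w)%:E - l%:E * (h w)%:E)%E) => //.
    by move=> w _; rewrite -EFinM -EFinB mulrBl.
  apply: integrableB => //; last exact: integrableZl.
  exact: (bernoulli_variable_mul_integrable (eps01 rn) ih).
split => //; apply: (@info_orthogonal _ _ _ _ M eps z r _ h (ltnW rn) iF) => // A cA.
have mA := cylinder_before_measurable cA.
under eq_integral do rewrite EFinB.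
rewrite integralB//; last 2 first.
- by apply: integrableS (eps_integrable rn).
- exact: finite_measure_integrable_cst.
rewrite integral_cst// (integral_indep_event mA (eps_integrable rn)); last first.
  exact: (cylinder_before_indep indep (j := inl (Ordinal rn)) cA).
rewrite (bernoulli_variable_moment1 (eps01 rn) (eps_bernoulli rn)).
suff : (Pr A * l%:E - l%:E * Pr A = 0)%E by [].
by rewrite muleC subee// fin_numM// fin_num_measure.
Qed.

Let integral_z_cylinder r (A : set Omega) : (r < n)%N -> measurable A ->
  (forall B, measurable B -> Pr (z r @^-1` B `&` A) = Pr (z r @^-1` B) * Pr A)%E ->
  (\int[Pr]_(w in A) (z r w)%:E = 0)%E.
Proof.
move=> rn mA indA; rewrite integral_indep_event//; last first.
  exact: (Lfun2_integrable (z_Lfun2 rn)).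
by rewrite (normal_variable_moment1 (z_normal rn)) mule0.
Qed.

Lemma z_orthogonal r (h : Omega -> R) : (r < n)%N -> info_measurable r h ->
  h \in Lfun Pr 2%:E ->
  Pr.-integrable setT (fun w => (z r w * h w)%:E) /\
  (\int[Pr]_w (z r w * h w)%:E = 0)%E.
Proof.
move=> rn hr h2; have izh := integrable_mul (z_Lfun2 rn) h2.
split => //; apply: (@info_orthogonal _ _ _ _ M eps z r _ h (ltnW rn)) => //.
  exact: (Lfun2_integrable (z_Lfun2 rn)).
move=> A cA; apply: integral_z_cylinder => //.
  exact: cylinder_before_measurable cA.
exact: (cylinder_before_indep indep (j := inr (Ordinal rn)) cA).
Qed.

(** Adding the event of execution at time [r] fills the [eps] slot of that time but leaves its [z]
    slot free, so [z r] remains independent of the enlarged cylinder. *)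
Let cylinder_before_eps r (A : set Omega) (rn : (r < n)%N) :
  cylinder_before M eps z r A ->
  exists D : 'I_n + 'I_n -> set R,
    [/\ forall i, measurable (D i), D (inr (Ordinal rn)) = setT &
        A `&` eps r @^-1` [set 1] =
        \bigcap_i (@noise _ _ _ _ M eps z i @^-1` D i)].
Proof.
move=> [D [mD DT ->]].
exists (fun i => if i == inl (Ordinal rn) then [set 1] else D i).
split.
- by move=> i; case: ifP.
- by rewrite /= DT.
- apply/seteqP; split => w /=.
    by move=> [Dw ew] i _; case: eqP => [->//|_]; exact: Dw.
  move=> Dw; split; last by have := Dw (inl (Ordinal rn)) Logic.I; rewrite eqxx.
  move=> i _; have := Dw i Logic.I; case: eqP => // -> _.
  by rewrite DT.
Qed.

Lemma eps_z_orthogonal r (h : Omega -> R) : (r < n)%N -> info_measurable r h ->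
  h \in Lfun Pr 2%:E ->
  Pr.-integrable setT (fun w => (eps r w * z r w * h w)%:E) /\
  (\int[Pr]_w (eps r w * z r w * h w)%:E = 0)%E.
Proof.
move=> rn hr h2; have ez2 := eps_mul_Lfun2 rn (z_Lfun2 rn).
have iezh := integrable_mul ez2 h2.
split => //.
apply: (@info_orthogonal _ _ _ _ M eps z r (fun w => eps r w * z r w) h (ltnW rn)) => //.
  exact: Lfun2_integrable ez2.
move=> A cA; have mA := cylinder_before_measurable cA.
rewrite (integral_bernoulli_variable_mul (eps01 rn)).
have mAe : measurable (A `&` eps r @^-1` [set 1]).
  by apply: measurableI => //; exact: measurable_funPTI.
apply: integral_z_cylinder => //.
have [D [mD DT ->]] := cylinder_before_eps rn cA.
move=> B mB; exact: (mutually_independent_bigcap (j := inr (Ordinal rn)) indep).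
Qed.

Lemma noise_mean0 r (A B C : Omega -> R) (k : R) : (r < n)%N ->
  info_measurable r A -> info_measurable r B -> info_measurable r C ->
  Pr.-integrable setT (fun w => (A w)%:E) ->
  B \in Lfun Pr 2%:E -> C \in Lfun Pr 2%:E ->
  let N w := (eps r w - lambda M r * dt M) * A w + z r w * B w
             + eps r w * z r w * C w + k * (z r w ^+ 2 - 1) in
  Pr.-integrable setT (fun w => (N w)%:E) /\ (\int[Pr]_w (N w)%:E = 0)%E.
Proof.
move=> rn hA hB hC iA B2 C2 N.
have [iA' A0] := eps_orthogonal rn hA iA.
have [iB' B0] := z_orthogonal rn hB B2.
have [iC' C0] := eps_z_orthogonal rn hC C2.
have iz2 : Pr.-integrable setT (fun w => (z r w ^+ 2)%:E).
  exact: (Lfun2_integrable_sqr (z_Lfun2 rn)).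
have i1 : Pr.-integrable setT (fun=> 1%:E) by exact: finite_measure_integrable_cst.
have iz : Pr.-integrable setT (fun w => (z r w ^+ 2 - 1)%:E).
  exact: (eq_integrable measurableT (fun w => (z r w ^+ 2)%:E - 1%:E)%E _ _
    (integrableB measurableT iz2 i1)).
have z0 : (\int[Pr]_w (z r w ^+ 2 - 1)%:E = 0)%E.
  under eq_integral do rewrite EFinB.
  rewrite integralB// (normal_variable_moment2 (z_normal rn)) integral_cst//.
  suff : (1 - 1 * Pr setT = 0)%E by [].
  by rewrite mul1e probability_setT subee.
have iAB := integrableD measurableT iA' iB'.
have iABC := integrableD measurableT iAB iC'.
have ik := integrableZl measurableT k iz.
have NE w : (N w)%:E = (((eps r w - lambda M r * dt M) * A w)%:E
    + (z r w * B w)%:E + (eps r w * z r w * C w)%:E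
    + k%:E * (z r w ^+ 2 - 1)%:E)%E by [].
split.
  by apply: eq_integrable (integrableD measurableT iABC ik) => // w _; rewrite NE.
under eq_integral do rewrite NE.
rewrite integralD// integralD// integralD// integralZl//.
by rewrite A0 B0 C0 z0 mule0 !adde0.
Qed.

End noise_moments.

(** * One step of the backward recursion *)

Section one_step.
Context (R : realType) (M : dark_market R).
Implicit Types (s : nat) (u : R) (P : 'M[R]_2) (b : 'cV[R]_2) (x : 'cV[R]_2).

Lemma sum_ord2 (F : 'I_2 -> R) : \sum_i F i = F 0 + F 1.
Proof. by rewrite big_ord_recl big_ord1; congr (_ + F _); apply/val_inj. Qed.

Lemma quadratic_formE P x : (x^T *m P *m x) 0 0 =
  P 0 0 * x 0 0 ^+ 2 + (P 0 1 + P 1 0) * x 0 0 * x 1 0 + P 1 1 * x 1 0 ^+ 2.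
Proof. by rewrite !(mxE, sum_ord2, big_ord1); ring. Qed.

Lemma dotE b x : (b^T *m x) 0 0 = b 0 0 * x 0 0 + b 1 0 * x 1 0.
Proof. by rewrite !(mxE, sum_ord2, big_ord1). Qed.

Lemma g_stepE s P : g_step M s P = theta M s + a_ M s / vol M s * P 1 1.
Proof. by rewrite /g_step /e2 !(mxE, sum_ord2, big_ord1) /=; ring. Qed.

Lemma k_stepE0 s P : k_step M s P 0 0 =
  (g_step M s P)^-1 * (P 0 1 * (1 - kappa M s * dt M) - 2^-1).
Proof. by rewrite /k_step /e1 /e2 /I2 /J2 !(mxE, sum_ord2, big_ord1) /=; ring. Qed.

Lemma k_stepE1 s P : k_step M s P 1 0 = (g_step M s P)^-1 * P 1 1.
Proof. by rewrite /k_step /e1 /e2 /I2 /J2 !(mxE, sum_ord2, big_ord1) /=; ring. Qed.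

Lemma f_stepE u s P b : f_step M u s P b = (g_step M s P)^-1 * 2^-1 *
  (b 1 0 + 2 * alpha M s * dt M * P 0 1
   - (vol M s * theta M s / lambda M s + Defs.eta M s) * u).
Proof. by rewrite /f_step /e1 /e2 !(mxE, sum_ord2, big_ord1) /=; ring. Qed.

Lemma P_stepE s P : P 0 1 = P 1 0 ->
  let g := g_step M s P in let k := k_step M s P in
  let c := dt M * (a_ M s * lambda M s / vol M s) * g in
  let m := 1 - kappa M s * dt M in
  [/\ P_step M s P 0 0 = m ^+ 2 * P 0 0 - c * k 0 0 ^+ 2,
      P_step M s P 0 1 = m * P 0 1 - c * k 0 0 * k 1 0,
      P_step M s P 1 0 = m * P 0 1 - c * k 0 0 * k 1 0 &
      P_step M s P 1 1 = P 1 1 + dt M * beta M s - c * k 1 0 ^+ 2].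
Proof.
move=> Psym g k c m; rewrite /P_step /J2 /Delta.
by split; rewrite /k /c /g /m !(mxE, sum_ord2, big_ord1) /= ?Psym; ring.
Qed.

Lemma b_stepE u s P b : P 0 1 = P 1 0 ->
  let f := f_step M u s P b in let k := k_step M s P in
  let c := dt M * (a_ M s * lambda M s / vol M s) * g_step M s P in
  let m := 1 - kappa M s * dt M in
  b_step M u s P b 0 0 =
    m * b 0 0 - 2 * c * f * k 0 0 + 2 * alpha M s * dt M * m * P 0 0 /\
  b_step M u s P b 1 0 =
    b 1 0 - 2 * c * f * k 1 0 + 2 * alpha M s * dt M * P 0 1.
Proof.
move=> Psym f k c m; rewrite /b_step /J2 /I2 /e1.
by split; rewrite /k /c /m !(mxE, sum_ord2, big_ord1) /= -/f ?Psym; ring.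
Qed.

Lemma e_stepE u s P b (e : R) :
  let f := f_step M u s P b in
  let c := dt M * (a_ M s * lambda M s / vol M s) * g_step M s P in
  e_step M u s P b e =
    e + (sigma M s ^+ 2 + (alpha M s * dt M) ^+ 2) * P 0 0
    + alpha M s * dt M * b 0 0 - c * f ^+ 2.
Proof.
by move=> f c; rewrite /e_step /e1 !(mxE, sum_ord2, big_ord1) /= -/f /c; ring.
Qed.

Lemma next_stateE s x (ep zz y : R) :
  next_state M s x ep zz y 0 0 =
    (1 - kappa M s * dt M) * x 0 0 + alpha M s * dt M + sigma M s * zz /\
  next_state M s x ep zz y 1 0 = x 1 0 - a_ M s / vol M s * ep * y.
Proof.
rewrite /next_state /I2 /J2 /e1 /e2.
by split; rewrite !(mxE, sum_ord2, big_ord1) /=; ring.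
Qed.

Definition quadratic_value P b (e : R) x : R :=
  (x^T *m P *m x) 0 0 + (b^T *m x) 0 0 + e.

(** The coefficient of the execution indicator in bucket cost plus next value, after [ep ^+ 2 = ep]
    and apart from the part proportional to [zz]. The impact term [theta * a * u * y] is left out:
    it has no factor [ep]. *)
Definition eps_coef u s P b x (y : R) : R :=
  a_ M s / vol M s * (g_step M s P * y ^+ 2
    + (x 0 0 - 2 * (P 0 1 * (1 - kappa M s * dt M) * x 0 0 + P 1 1 * x 1 0)
       + Defs.eta M s * u - b 1 0 - 2 * alpha M s * dt M * P 0 1) * y).

Definition z_coef s P b x : R :=
  sigma M s * (2 * ((1 - kappa M s * dt M) * P 0 0 * x 0 0 + P 0 1 * x 1 0)
               + 2 * alpha M s * dt M * P 0 0 + b 0 0).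

(** Comes from the cross term [2 * P 0 1 * p * q] at the next state, where the shock to [p] meets
    the execution in [q]. *)
Definition eps_z_coef s P (y : R) : R :=
  - 2 * (a_ M s / vol M s) * sigma M s * P 0 1 * y.

(** Replacing [ep] by [lambda dt] and [zz ^+ 2] by [1], and dropping terms linear in [zz], leaves a
    quadratic polynomial in [y] with vertex [k^T x + f]. Its value at the vertex is what the
    backward step computes; the last bracket collects what the replacement changed. *)
Lemma one_step_identity u s P b (e : R) x (ep zz y : R) :
  P 0 1 = P 1 0 -> dt M != 0 -> vol M s != 0 -> lambda M s != 0 ->
  g_step M s P != 0 -> ep = 0 \/ ep = 1 ->
  stage_cost M u s x ep y * dt M
    + quadratic_value P b e (next_state M s x ep zz y) =
  quadratic_value (P_step M s P) (b_step M u s P b) (e_step M u s P b e) x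
  + a_ M s * lambda M s / vol M s * dt M * g_step M s P
    * (y - (((k_step M s P)^T *m x) 0 0 + f_step M u s P b)) ^+ 2
  + ((ep - lambda M s * dt M) * eps_coef u s P b x y + zz * z_coef s P b x
     + ep * zz * eps_z_coef s P y + sigma M s ^+ 2 * P 0 0 * (zz ^+ 2 - 1)).
Proof.
move=> Psym dt0 v0 l0 g0 ep01.
have [P00E P01E P10E P11E] := P_stepE s Psym.
have [b0E b1E] := b_stepE u s b Psym.
have [x0E x1E] := next_stateE s x ep zz y.
(* Eliminating [theta] in favour of [g] lets [g] be generalised to a nonzero unknown before [field]
   clears its inverse. *)
have thetaE : theta M s = g_step M s P - a_ M s / vol M s * P 1 1.
  by rewrite g_stepE addrK.
rewrite /quadratic_value /stage_cost /eps_coef /z_coef /eps_z_coef.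
rewrite !quadratic_formE !dotE P00E P01E P10E P11E b0E b1E e_stepE x0E x1E.
rewrite f_stepE k_stepE0 k_stepE1 thetaE -!Psym.
move: (g_step M s P) g0 => g g0.
move: (P 0 0) (P 0 1) (P 1 1) (b 0 0) (b 1 0) (x 0 0) (x 1 0).
move: (a_ M s) (vol M s) (lambda M s) (dt M) (kappa M s) v0 l0 dt0.
move=> a v l h kp v0 l0 h0 P00 P01 P11 b0 b1 p q.
(* The identity is false for arbitrary real [ep]; the two cases supply [ep ^+ 2 = ep]. *)
by case: ep01 => ->; field; rewrite v0 l0 g0 h0.
Qed.

Lemma g_step_gt0 s P : 0 < theta M s -> 0 < a_ M s -> 0 < vol M s ->
  0 <= P 1 1 -> 0 < g_step M s P.
Proof.
by move=> th0 a0 v0 P0; rewrite g_stepE ltr_wpDr// mulr_ge0// ltW// divr_gt0.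
Qed.

(** Apart from the [beta] term the new entry is [P 1 1 * (1 - lambda dt * q)] with
    [q = (a / v) * P 1 1 / g]. Since [g] is the numerator [(a / v) * P 1 1] plus [theta > 0], [q]
    lies between 0 and 1. *)
Lemma P_step_ge0 s P : P 0 1 = P 1 0 -> 0 < theta M s -> 0 < a_ M s -> 0 < vol M s ->
  0 <= dt M -> 0 < lambda M s -> lambda M s * dt M <= 1 -> 0 <= beta M s ->
  0 <= P 1 1 -> 0 <= P_step M s P 1 1.
Proof.
move=> Psym th0 a0 v0 dt0 l0 l1 be0 P0.
have [_ _ _ ->] := P_stepE s Psym; rewrite k_stepE1.
have g0 := g_step_gt0 th0 a0 v0 P0.
have c0 : 0 < a_ M s / vol M s by exact: divr_gt0.
rewrite addrAC addr_ge0 ?mulr_ge0//.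
have -> : P 1 1 - dt M * (a_ M s * lambda M s / vol M s) * g_step M s P
    * ((g_step M s P)^-1 * P 1 1) ^+ 2 =
  P 1 1 * (1 - (lambda M s * dt M) * ((a_ M s / vol M s * P 1 1) / g_step M s P)).
  by field; rewrite !gt_eqF.
have q0 : 0 <= a_ M s / vol M s * P 1 1 / g_step M s P.
  by rewrite divr_ge0 ?(mulr_ge0 (ltW c0))// ltW.
have q1 : a_ M s / vol M s * P 1 1 / g_step M s P <= 1.
  by rewrite ler_pdivrMr// mul1r [leRHS]g_stepE lerDr ltW.
by rewrite mulr_ge0// subr_ge0 mulr_ile1// mulr_ge0// ltW.
Qed.

End one_step.

(** * The backward recursion along the time grid *)

Section backward_recursion.
Context (R : realType) (M : dark_market R) (u : R).
Local Notation n := (nstep M).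

Lemma coeffs_step s : (s < n)%N ->
  [/\ PD M u s = P_step M s (PD M u s.+1),
      bD M u s = b_step M u s (PD M u s.+1) (bD M u s.+1) &
      eD M u s = e_step M u s (PD M u s.+1) (bD M u s.+1) (eD M u s.+1)].
Proof.
(* [coeffs] counts the buckets left, and its successor case reads the parameters at a truncated
   difference; for [s < n] that difference is [s] itself. *)
move=> sn; have sE : (n - (n - s.+1).+1)%N = s by rewrite subnSK// subKn// ltnW.
have cE : coeffs M u (n - s) = coeffs M u (n - s.+1).+1 by rewrite subnSK.
rewrite /PD /bD /eD cE [coeffs M u (n - s.+1).+1]/=.
case: (coeffs M u (n - s.+1)) => [[P b] e].
by rewrite sE.
Qed.

Lemma coeffs_end : [/\ PD M u n = betaT M *: delta_mx 1 1, bD M u n = 0 & eD M u n = 0].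
Proof. by rewrite /PD /bD /eD subnn. Qed.

Lemma PD_sym_ge0 s :
  0 < dt M -> (forall s, (s < n)%N -> 0 < a_ M s) ->
  (forall s, (s < n)%N -> 0 < vol M s) ->
  (forall s, (s < n)%N -> 0 < theta M s) ->
  (forall s, (s < n)%N -> 0 < lambda M s) ->
  (forall s, (s < n)%N -> lambda M s * dt M <= 1) ->
  (forall s, (s < n)%N -> 0 <= beta M s) -> 0 <= betaT M ->
  (s <= n)%N -> PD M u s 0 1 = PD M u s 1 0 /\ 0 <= PD M u s 1 1.
Proof.
move=> dt0 a0 v0 th0 l0 l1 be0 beT0; move: s.
suff H m : (m <= n)%N ->
    PD M u (n - m) 0 1 = PD M u (n - m) 1 0 /\ 0 <= PD M u (n - m) 1 1.
  by move=> s sn; have := H (n - s)%N (leq_subr _ _); rewrite subKn.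
elim: m => [_|m IH mn].
  rewrite subn0; have [-> _ _] := coeffs_end.
  by rewrite !mxE /= !mulr0 mulr1.
have [Psym P0] := IH (ltnW mn).
have sn : (n - m.+1 < n)%N by rewrite subnSK// leq_subr.
have [-> _ _] := coeffs_step sn; rewrite subnSK//.
split; last by apply: P_step_ge0; rewrite ?a0 ?v0 ?th0 ?l0 ?l1 ?be0// ltW.
by have [_ -> -> _] := @P_stepE _ M (n - m.+1)%N _ Psym.
Qed.

End backward_recursion.

(** * Adapted controls and verification *)

Section controlled_process.
Context d (Omega : measurableType d) (R : realType) (Pr : probability Omega R).
Context (M : dark_market R) (eps z : nat -> {RV Pr >-> R}).
Local Notation n := (nstep M).
Local Notation state := (state M eps z).
Implicit Types (r s : nat) (x : 'cV[R]_2) (y : nat -> Omega -> R).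

Lemma stateS s x y r w : (s <= r)%N ->
  state s x y r.+1 w = next_state M r (state s x y r w) (eps r w) (z r w) (y r w).
Proof. by move=> sr /=; rewrite sr. Qed.

Lemma state_start s x y w : state s x y s w = x.
Proof. by case: s => //= s; rewrite ltnn. Qed.

Definition adapted r (f : Omega -> R) : Prop :=
  info_measurable eps z r f /\ f \in Lfun Pr 2%:E.

Lemma admissibleP s y : admissible M eps z s y <->
  forall r, (s <= r < n)%N -> adapted r (y r).
Proof.
split=> H r sr; have [yr y2] := H r sr; split => //.
- exact/info_measurableP.
- exact/info_measurableP.
Qed.

Lemma adapted_cst r c : adapted r (fun=> c).
Proof. by split; [exact: measurable_cst|exact: Lfun_cst]. Qed.

Lemma adaptedD r f g : adapted r f -> adapted r g -> adapted r (fun w => f w + g w).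
Proof.
by move=> [mf f2] [mg g2]; split; [exact: measurable_funD|exact: Lfun2D].
Qed.

Lemma adaptedZ r c f : adapted r f -> adapted r (fun w => c * f w).
Proof.
by move=> [mf f2]; split; [exact: measurable_funM|exact: Lfun2Z].
Qed.

Lemma adapted_le r r' f : (r <= r')%N -> adapted r f -> adapted r' f.
Proof. by move=> rr' [mf f2]; split => //; exact: info_measurable_le mf. Qed.

Lemma eq_adapted r f g : f =1 g -> adapted r f -> adapted r g.
Proof. by move=> /funext ->. Qed.

Lemma adapted_affine r (c0 c1 c2 : R) f g : adapted r f -> adapted r g ->
  adapted r (fun w => c0 + c1 * f w + c2 * g w).
Proof.
move=> hf hg; apply: adaptedD; last exact: adaptedZ.
by apply: adaptedD; [exact: adapted_cst|exact: adaptedZ].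
Qed.

Context (eps01 : forall s, (s < n)%N -> forall w, eps s w = 0 \/ eps s w = 1)
  (z_normal : forall s, (s < n)%N -> forall B : set R, measurable B ->
     distribution Pr (z s) B = normal_prob 0 1 B).

Lemma adapted_eps_mul r f : (r < n)%N -> adapted r f ->
  adapted r.+1 (fun w => eps r w * f w).
Proof.
move=> rn [mf f2]; split; last exact: (eps_mul_Lfun2 eps01 rn f2).
apply: measurable_funM; first exact: info_measurable_eps.
exact: info_measurable_le mf.
Qed.

Lemma adapted_z r : (r < n)%N -> adapted r.+1 (z r).
Proof.
by move=> rn; split; [exact: info_measurable_z|exact: (z_Lfun2 z_normal rn)].
Qed.

(** Only controls strictly before [r] are constrained, so the lemma can be used on a control whose
    adaptedness at time [r] is still to be proved. *)
Lemma state_adapted s x y r : (s <= r <= n)%N ->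
  (forall r', (s <= r' < r)%N -> adapted r' (y r')) ->
  adapted r (fun w => state s x y r w 0 0) /\
  adapted r (fun w => state s x y r w 1 0).
Proof.
elim: r => [|r IH] /andP[sr rn] hy.
  by split; exact: adapted_cst.
move: sr; rewrite leq_eqVlt => /predU1P[sE|sr].
  by split; [apply: (@eq_adapted _ (fun=> x 0 0))|apply: (@eq_adapted _ (fun=> x 1 0))];
    do ?exact: adapted_cst; move=> w; rewrite -sE state_start.
rewrite ltnS in sr.
have [||hp hq] := IH; first by rewrite sr ltnW.
  by move=> r' /andP[sr' r'r]; apply: hy; rewrite sr' ltnS ltnW.
have hyr : adapted r (y r) by apply: hy; rewrite sr ltnSn.
split.
- apply: (@eq_adapted _ (fun w => alpha M r * dt M
      + (1 - kappa M r * dt M) * state s x y r w 0 0 + sigma M r * z r w)).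
    move=> w; rewrite stateS//.
    by have [-> _] := next_stateE M r (state s x y r w) (eps r w) (z r w) (y r w); ring.
  by apply: adapted_affine; [exact: (adapted_le (leqnSn r) hp)|exact: adapted_z].
- apply: (@eq_adapted _ (fun w => 0 + 1 * state s x y r w 1 0
      + (- (a_ M r / vol M r)) * (eps r w * y r w))).
    move=> w; rewrite stateS//.
    by have [_ ->] := next_stateE M r (state s x y r w) (eps r w) (z r w) (y r w); ring.
  by apply: adapted_affine; [exact: (adapted_le (leqnSn r) hq)|exact: adapted_eps_mul].
Qed.

Context (u : R).

(** The closed-loop trajectory, defined without naming a control: the feedback law needs the state
    and [state] needs a control, and this recursion breaks the circle. *)
Fixpoint feedback_state s x r (w : Omega) : 'cV[R]_2 :=
  if r is r'.+1 then
    if (s <= r')%N then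
      let X := feedback_state s x r' w in
      next_state M r' X (eps r' w) (z r' w)
        (((kD M u r')^T *m X) 0 0 + fD M u r')
    else x
  else x.

Definition feedback s x r (w : Omega) : R :=
  ((kD M u r)^T *m feedback_state s x r w) 0 0 + fD M u r.

Lemma state_feedback s x r w : state s x (feedback s x) r w = feedback_state s x r w.
Proof. by elim: r => //= r ->. Qed.

Lemma feedback_admissible s x : admissible M eps z s (feedback s x).
Proof.
(* Induction on the horizon: controls before [r] are adapted, hence so is the state at [r], hence so
   is the feedback at [r], an affine function of it. *)
suff H r : (s <= r <= n)%N ->
    forall r', (s <= r' < r)%N -> adapted r' (feedback s x r').
  apply/admissibleP => r /andP[sr rn].
  by apply: (H r.+1); [rewrite (leqW sr)|rewrite sr ltnSn].
elim: r => [_ r'|r IH /andP[sr rn] r' /andP[sr']]; first by rewrite ltn0 andbF.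
rewrite ltnS leq_eqVlt => /predU1P[r'E|r'r]; last first.
  apply: IH; last by rewrite sr'.
  by rewrite (leq_trans sr' (ltnW r'r)) (ltnW rn).
have srn : (s <= r <= n)%N by rewrite -r'E sr' r'E ltnW.
have [hp hq] := state_adapted x srn (IH srn).
rewrite r'E; apply: (@eq_adapted _ (fun w => fD M u r
  + kD M u r 0 0 * state s x (feedback s x) r w 0 0
  + kD M u r 1 0 * state s x (feedback s x) r w 1 0)).
  by move=> w; rewrite /feedback dotE state_feedback; ring.
exact: adapted_affine.
Qed.

End controlled_process.

(** * Expected cost of an admissible control, and verification *)

Section verification.
Context d (Omega : measurableType d) (R : realType) (Pr : probability Omega R).
Context (M : dark_market R) (eps z : nat -> {RV Pr >-> R}) (u : R).
Local Notation n := (nstep M).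
Local Notation state := (state M eps z).
Local Notation admissible := (admissible M eps z).
Local Notation adapted := (adapted eps z).
Context (dt_gt0 : 0 < dt M) (Q0_gt0 : 0 < Q0 M)
  (v_gt0 : forall s, (s < n)%N -> 0 < vol M s)
  (theta_gt0 : forall s, (s < n)%N -> 0 < theta M s)
  (lambda_gt0 : forall s, (s < n)%N -> 0 < lambda M s)
  (lambda_dt_le1 : forall s, (s < n)%N -> lambda M s * dt M <= 1)
  (beta_ge0 : forall s, (s < n)%N -> 0 <= beta M s)
  (betaT_ge0 : 0 <= betaT M)
  (eps01 : forall s, (s < n)%N -> forall w, eps s w = 0 \/ eps s w = 1)
  (eps_bernoulli : forall s, (s < n)%N ->
     Pr (eps s @^-1` [set 1]) = (lambda M s * dt M)%:E)
  (z_normal : forall s, (s < n)%N -> forall B : set R, measurable B ->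
     distribution Pr (z s) B = normal_prob 0 1 B)
  (indep : mutually_independent (@noise d Omega R Pr M eps z)).
Implicit Types (r s : nat) (x : 'cV[R]_2) (y : nat -> Omega -> R).

Let a_gt0 s : (s < n)%N -> 0 < a_ M s.
Proof. by move=> sn; rewrite divr_gt0// v_gt0. Qed.

Let PD_props s : (s <= n)%N -> PD M u s 0 1 = PD M u s 1 0 /\ 0 <= PD M u s 1 1.
Proof. exact: PD_sym_ge0. Qed.

Lemma gD_gt0 r : (r < n)%N -> 0 < gD M u r.
Proof.
move=> rn; have [_ P0] := PD_props rn.
by apply: g_step_gt0 => //; [exact: theta_gt0|exact: a_gt0|exact: v_gt0].
Qed.

Definition candidate s x : R :=
  quadratic_value (PD M u s) (bD M u s) (eD M u s) x.

Definition deviation s x y r w : R :=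
  y r w - (((kD M u r)^T *m state s x y r w) 0 0 + fD M u r).

Definition deviation_weight r : R :=
  a_ M r * lambda M r / vol M r * dt M * gD M u r.

Definition martingale_increment s x y r w : R :=
  (eps r w - lambda M r * dt M)
    * eps_coef M u r (PD M u r.+1) (bD M u r.+1) (state s x y r w) (y r w)
  + z r w * z_coef M r (PD M u r.+1) (bD M u r.+1) (state s x y r w)
  + eps r w * z r w * eps_z_coef M r (PD M u r.+1) (y r w)
  + sigma M r ^+ 2 * PD M u r.+1 0 0 * (z r w ^+ 2 - 1).

Lemma deviation_weight_gt0 r : (r < n)%N -> 0 < deviation_weight r.
Proof.
move=> rn; rewrite mulr_gt0 ?gD_gt0// mulr_gt0// divr_gt0 ?v_gt0//.
by rewrite mulr_gt0 ?a_gt0 ?lambda_gt0.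
Qed.

Lemma pathwise_step s x y r w : (s <= r < n)%N ->
  stage_cost M u r (state s x y r w) (eps r w) (y r w) * dt M
    + candidate r.+1 (state s x y r.+1 w) =
  candidate r (state s x y r w)
    + (deviation_weight r * deviation s x y r w ^+ 2
       + martingale_increment s x y r w).
Proof.
move=> /andP[sr rn]; rewrite stateS// /candidate.
have [Psym P0] := PD_props rn; have [-> -> ->] := coeffs_step u rn.
rewrite one_step_identity ?addrA//.
- by rewrite gt_eqF.
- by rewrite gt_eqF// v_gt0.
- by rewrite gt_eqF// lambda_gt0.
- by rewrite gt_eqF// gD_gt0.
- exact: eps01.
Qed.

Lemma total_costE s x y w : (s <= n)%N ->
  total_cost M eps z u s x y w = candidate s x
    + \sum_(s <= r < n) (deviation_weight r * deviation s x y r w ^+ 2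
                         + martingale_increment s x y r w).
Proof.
(* The telescoping is stated up to an intermediate time [m]; at [m = n] the candidate is the
   terminal cost. *)
move=> sn; have H m : (s <= m <= n)%N ->
    \sum_(s <= r < m)
      stage_cost M u r (state s x y r w) (eps r w) (y r w) * dt M
    + candidate m (state s x y m w) = candidate s x
    + \sum_(s <= r < m) (deviation_weight r * deviation s x y r w ^+ 2
                         + martingale_increment s x y r w).
  elim: m => [|m IH] /andP[].
    by rewrite leqn0 => /eqP -> _; rewrite !big_geq// add0r addr0.
  rewrite leq_eqVlt => /predU1P[<- _|sm mn].
    by rewrite state_start !big_geq// add0r addr0.
  rewrite ltnS in sm; rewrite !big_nat_recr//= -addrA pathwise_step ?sm//.
  by rewrite addrA IH ?addrA// sm ltnW.
rewrite /total_cost -H ?sn ?leqnn//; congr (_ + _).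
have [Pn bn en] := coeffs_end M u.
rewrite /terminal_cost /candidate /quadratic_value Pn bn en trmx0 mul0mx.
by rewrite quadratic_formE !mxE /=; ring.
Qed.

Section admissible_control.
Context (s : nat) (x : 'cV[R]_2) (y : nat -> Omega -> R).
Context (y_adm : admissible s y).

Let y_adapted r : (s <= r < n)%N -> adapted r (y r).
Proof. by move/admissibleP : y_adm; apply. Qed.

Let state_adapted_y r : (s <= r < n)%N ->
  adapted r (fun w => state s x y r w 0 0) /\
  adapted r (fun w => state s x y r w 1 0).
Proof.
move=> /andP[sr rn]; apply: (state_adapted eps01 z_normal); first by rewrite sr ltnW.
by move=> r' /andP[sr' r'r]; apply: y_adapted; rewrite sr' (ltn_trans r'r).
Qed.

Lemma deviation_adapted r : (s <= r < n)%N -> adapted r (deviation s x y r).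
Proof.
move=> srn; have [hp hq] := state_adapted_y srn.
apply: (@eq_adapted _ _ _ _ eps z r (fun w => (- fD M u r
    + (- kD M u r 0 0) * state s x y r w 0 0
    + (- kD M u r 1 0) * state s x y r w 1 0) + 1 * y r w)).
  by move=> w; rewrite /deviation dotE; ring.
by apply: adaptedD; [exact: adapted_affine|apply/adaptedZ/y_adapted].
Qed.

Lemma martingale_increment_mean0 r : (s <= r < n)%N ->
  Pr.-integrable setT (fun w => (martingale_increment s x y r w)%:E) /\
  (\int[Pr]_w (martingale_increment s x y r w)%:E = 0)%E.
Proof.
move=> srn; have [hp hq] := state_adapted_y srn; have hy := y_adapted srn.
have rn : (r < n)%N by have /andP[] := srn.
pose P := PD M u r.+1; pose b := bD M u r.+1.
pose c := a_ M r / vol M r; pose m := 1 - kappa M r * dt M.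
have hA : adapted r (fun w =>
    (c * (Defs.eta M r * u - b 1 0 - 2 * alpha M r * dt M * P 0 1)
     + c * (1 - 2 * P 0 1 * m) * state s x y r w 0 0
     + - (2 * c * P 1 1) * state s x y r w 1 0)
    + c * g_step M r P * y r w).
  by apply: adaptedD; [exact: adapted_affine|exact: adaptedZ].
(* Pulling out one factor [y] exhibits the coefficient as a product of two adapted square-integrable
   functions, hence integrable. *)
have AE w : eps_coef M u r P b (state s x y r w) (y r w) =
    (c * (Defs.eta M r * u - b 1 0 - 2 * alpha M r * dt M * P 0 1)
     + c * (1 - 2 * P 0 1 * m) * state s x y r w 0 0
     + - (2 * c * P 1 1) * state s x y r w 1 0
     + c * g_step M r P * y r w) * y r w.
  by rewrite /eps_coef -/c -/m; ring.
have [mB B2] : adapted r (fun w => z_coef M r P b (state s x y r w)).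
  apply: (@eq_adapted _ _ _ _ eps z r (fun w =>
    sigma M r * (2 * alpha M r * dt M * P 0 0 + b 0 0)
    + (sigma M r * 2 * m * P 0 0) * state s x y r w 0 0
    + (sigma M r * 2 * P 0 1) * state s x y r w 1 0)).
    by move=> w; rewrite /z_coef -/m; ring.
  exact: adapted_affine.
have [mC C2] : adapted r (fun w => eps_z_coef M r P (y r w)) by exact: adaptedZ.
apply: (noise_mean0 eps01 eps_bernoulli z_normal indep) => //.
- under eq_fun do rewrite -/P -/b AE.
  by apply: measurable_funM; [exact: (proj1 hA)|exact: (proj1 hy)].
- under eq_fun do rewrite -/P -/b AE.
  by apply: integrable_mul; [exact: (proj2 hA)|exact: (proj2 hy)].
Qed.

Let deviation_sqr_integrable r : (s <= r < n)%N ->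
  Pr.-integrable setT (fun w => (deviation s x y r w ^+ 2)%:E).
Proof. by move=> srn; exact: (Lfun2_integrable_sqr (proj2 (deviation_adapted srn))). Qed.

(** Integrability of the partial sums [W m] is proved together with their integral, since the
    increments are signed and the integral of a sum may be split only under integrability. *)
Lemma expectation_total_cost : (s <= n)%N ->
  ('E_Pr[total_cost M eps z u s x y] = (candidate s x)%:E
    + \sum_(s <= r < n) (deviation_weight r)%:E
        * \int[Pr]_w (deviation s x y r w ^+ 2)%:E)%E.
Proof.
move=> sn; pose W m w := \sum_(s <= r < m)
  (deviation_weight r * deviation s x y r w ^+ 2 + martingale_increment s x y r w).
have W0 m : (m <= s)%N -> (fun w => (W m w)%:E) = cst 0%E.
  by move=> ms; apply/funext => w; rewrite /W big_geq.
have H m : (s <= m <= n)%N ->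
    Pr.-integrable setT (fun w => (W m w)%:E) /\
    (\int[Pr]_w (W m w)%:E =
     \sum_(s <= r < m) (deviation_weight r)%:E
        * \int[Pr]_w (deviation s x y r w ^+ 2)%:E)%E.
  elim: m => [|m IH] /andP[sm mn].
    by rewrite W0// big_geq//; split; [exact: integrable0|exact: integral0].
  move: sm; rewrite leq_eqVlt => /predU1P[sE|sm].
    by rewrite W0 -?sE// big_geq//; split; [exact: integrable0|exact: integral0].
  rewrite ltnS in sm.
  have smn : (s <= m < n)%N by rewrite sm.
  have [iS SE] := IH (introT andP (conj sm (ltnW mn))).
  have [iN N0] := martingale_increment_mean0 smn.
  have iD := integrableZl measurableT (deviation_weight m) (deviation_sqr_integrable smn).
  have iDN := integrableD measurableT iD iN.
  rewrite big_nat_recr//= -SE; split.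
    apply: eq_integrable (integrableD measurableT iS iDN) => // w _.
    by rewrite /W big_nat_recr.
  under eq_integral do rewrite /W big_nat_recr//= !EFinD EFinM.
  rewrite integralD// integralD// integralZl//; last exact: deviation_sqr_integrable.
  by rewrite N0 adde0.
have [iS SE] := H n (introT andP (conj sn (leqnn n))).
rewrite unlock -SE; under eq_integral do rewrite total_costE// EFinD.
rewrite integralD//; last exact: finite_measure_integrable_cst.
congr (_ + _)%E; rewrite integral_cst//.
suff : ((candidate s x)%:E * Pr setT = (candidate s x)%:E)%E by [].
by rewrite probability_setT mule1.
Qed.

Let penalty_ge0 r : (s <= r < n)%N ->
  (0 <= (deviation_weight r)%:E * \int[Pr]_w (deviation s x y r w ^+ 2)%:E)%E.
Proof.
move=> /andP[_ rn]; apply: mule_ge0.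
  by rewrite lee_fin ltW// deviation_weight_gt0.
by apply: integral_ge0 => w _; rewrite lee_fin sqr_ge0.
Qed.

Lemma candidate_le_cost : (s <= n)%N ->
  ((candidate s x)%:E <= 'E_Pr[total_cost M eps z u s x y])%E.
Proof.
move=> sn; rewrite expectation_total_cost// leeDl// big_nat_cond.
by apply: sume_ge0 => r; rewrite andbT => srn; exact: penalty_ge0.
Qed.

(** The excess over the finite candidate value is a sum of nonnegative terms with positive weights,
    so it vanishes exactly when each squared deviation has zero integral, that is, when each
    deviation is zero almost everywhere. *)
Lemma candidate_eq_cost : (s <= n)%N ->
  ('E_Pr[total_cost M eps z u s x y] = (candidate s x)%:E)%E <->
  forall r, (s <= r < n)%N ->
    {ae Pr, forall w, y r w = ((kD M u r)^T *m state s x y r w) 0 0 + fD M u r}.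
Proof.
move=> sn; rewrite expectation_total_cost//.
have aeP r : (s <= r < n)%N ->
    (\int[Pr]_w (deviation s x y r w ^+ 2)%:E = 0)%E <->
    {ae Pr, forall w, y r w = ((kD M u r)^T *m state s x y r w) 0 0 + fD M u r}.
  move=> srn; have mD := measurable_int _ (deviation_sqr_integrable srn).
  have := ae_eq_integral_abs Pr measurableT mD.
  rewrite (_ : (\int[Pr]_w `|(deviation s x y r w ^+ 2)%:E|)%E =
               (\int[Pr]_w (deviation s x y r w ^+ 2)%:E)%E); last first.
    by apply: eq_integral => w _; rewrite gee0_abs// lee_fin sqr_ge0.
  move=> ->; split; apply: filterS => w /=.
    move=> /(_ Logic.I) /(congr1 fine) /= /eqP.
    by rewrite sqrf_eq0 subr_eq0 => /eqP.
  by move=> yE _; rewrite /deviation yE subrr expr0n.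
split=> [E0 r srn|yE].
- apply/aeP => //; move: E0 => /(congr1 (fun v => v - (candidate s x)%:E)%E).
  rewrite addeAC subee// add0e big_nat_cond => /eqP.
  rewrite seq_psume_eq0; last by move=> i; rewrite andbT; exact: penalty_ge0.
  move=> /allP /(_ r); rewrite mem_index_iota => /(_ srn); rewrite srn /=.
  rewrite mule_eq0 => /orP[|/eqP//].
  by rewrite eqe gt_eqF// deviation_weight_gt0//; case/andP: srn.
- rewrite big_nat_cond big1 ?adde0// => r; rewrite andbT => srn.
  by have [_ ->] := aeP _ srn; rewrite ?mule0//; exact: yE.
Qed.

End admissible_control.

Lemma feedback_cost s x : (s <= n)%N ->
  ('E_Pr[total_cost M eps z u s x (feedback M eps z u s x)] = (candidate s x)%:E)%E.
Proof.
move=> sn; apply/candidate_eq_cost => //; first exact: feedback_admissible.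
by move=> r srn; apply: aeW => w; rewrite /feedback state_feedback.
Qed.

Lemma value_candidate s x : (s <= n)%N -> value M eps z u s x = (candidate s x)%:E.
Proof.
move=> sn; apply/eqP; rewrite eq_le; apply/andP; split.
  apply: ereal_inf_lbound; exists (feedback M eps z u s x); last exact: feedback_cost.
  exact: feedback_admissible.
by apply: le_ereal_inf_tmp => _ [y y_adm <-]; exact: candidate_le_cost.
Qed.

End verification.

(** The rate [u] is frozen at the starting time [t] while [s] varies. Existence gives the feedback
    law at every outcome; the characterisation of optimal controls holds almost everywhere, since
    expected cost is blind to null sets. *)
Theorem theorem6 (d : measure_display) (Omega : measurableType d)
    (R : realType) (Pr : probability Omega R)
    (M : dark_market R) (ubar : nat -> R) (eps z : nat -> {RV Pr >-> R})
    (dt_gt0 : 0 < dt M) (n_ge1 : (1 <= nstep M)%N) (Q0_gt0 : 0 < Q0 M)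
    (v_gt0 : forall s, (s < nstep M)%N -> 0 < vol M s)
    (theta_gt0 : forall s, (s < nstep M)%N -> 0 < theta M s)
    (lambda_gt0 : forall s, (s < nstep M)%N -> 0 < lambda M s)
    (lambda_dt_le1 : forall s, (s < nstep M)%N -> lambda M s * dt M <= 1)
    (beta_ge0 : forall s, (s < nstep M)%N -> 0 <= beta M s)
    (betaT_ge0 : 0 <= betaT M)
    (eps01 : forall s, (s < nstep M)%N ->
       forall w, eps s w = 0 \/ eps s w = 1)
    (eps_bernoulli : forall s, (s < nstep M)%N ->
       Pr (eps s @^-1` [set 1]) = (lambda M s * dt M)%:E)
    (z_normal : forall s, (s < nstep M)%N ->
       forall B : set R, measurable B ->
         distribution Pr (z s) B = normal_prob 0 1 B)
    (indep : mutually_independent (@noise d Omega R Pr M eps z))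
    (t : nat) (t_le_n : (t <= nstep M)%N) :
  let u := ubar t in
  (forall (s : nat) (x : 'cV[R]_2), (t <= s <= nstep M)%N ->
     value M eps z u s x =
     ((x^T *m PD M u s *m x) 0 0 + ((bD M u s)^T *m x) 0 0 + eD M u s)%:E) /\
  (forall (s : nat) (x : 'cV[R]_2), (t <= s <= nstep M)%N ->
     (exists y : nat -> Omega -> R,
        optimal M eps z u s x y /\
        forall r, (s <= r < nstep M)%N -> forall w,
          y r w = ((kD M u r)^T *m state M eps z s x y r w) 0 0 + fD M u r) /\
     (forall y : nat -> Omega -> R, admissible M eps z s y ->
        (optimal M eps z u s x y <->
         forall r, (s <= r < nstep M)%N ->
           {ae Pr, forall w,
             y r w = ((kD M u r)^T *m state M eps z s x y r w) 0 0
                     + fD M u r}))).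
Proof.
move=> u; split=> s x /andP[_ sn]; first exact: value_candidate.
split=> [|y y_adm].
  exists (feedback M eps z u s x); split; last first.
    by move=> r _ w; rewrite /feedback state_feedback.
  split; first exact: feedback_admissible.
  by rewrite value_candidate// feedback_cost.
rewrite /optimal value_candidate//.
split=> [[_ yE]|yE].
- by apply: iffLR yE; exact: candidate_eq_cost.
- by split=> //; apply: iffRL yE; exact: candidate_eq_cost.
Qed.
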